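(* Let $p,q\in(0,\infty]$ and $m,n\in\mathbb{N}$, and let $X=(X_{i,j})_{i\le m,j\le n}$ be uniformly distributed on $\mathbb{B}_{p,q}^{m,n}$. Put $R_i:=\lVert (X_{i,j})_{j\le n}\rVert_q$ and $\Theta_i:=(\Theta_{i,j})_{j\le n}:=(X_{i,j}/R_i)_{j\le n}$ for $i\in\{1,\dots,m\}$ ($\Theta_i$ is almost surely well defined). (a) The distribution of $(R_i)_{i\le m}$ has Lebesgue density $$f(r_1,\dots,r_m)=\frac{(2n)^m}{\omega_{p/n}^m}\prod_{i=1}^m r_i^{n-1}\cdot \mathbf{1}_{\mathbb{B}_p^m\cap[0,\infty)^m}(r_1,\dots,r_m).$$ Therefore $(R_i)_{i\le m}$ can be represented as $$(R_i)_{i\le m}\overset{d}{=}\begin{cases} U^{1/(mn)}\Bigl(\dfrac{|\xi_i|^{1/n}}{(\sum_{k=1}^m|\xi_k|^{p/n})^{1/p}}\Bigr)_{i\le m} & \text{if } p<\infty,\\ (|\xi_i|^{1/n})_{i\le m} & \text{if } p=\infty,\end{cases}$$ where $U,\xi_1,\dots,\xi_m$ are independent random variables, $U$ is uniformly distributed on $[0,1]$, and $\xi_1,\dots,\xi_m$ are $\frac{p}{n}$-Gaussian. (b) The random vectors $(R_i)_{i\le m},\Theta_1,\dots,\Theta_m$ are all independent, each $\Theta_i$ is distributed according to the cone measure on $\mathbb{S}_q^{n-1}$, and therefore can be represented as $$\Theta_i\overset{d}{=}\Bigl(\frac{\eta_{i,j}}{\lVert(\eta_{i,l})_{l\le n}\rVert_q}\Bigr)_{j\le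 n},$$ where $(\eta_{i,j})_{i\le m,j\le n}$ is an array of independent $q$-Gaussian random variables. (c) The components of $X$ have the (joint) representation $$X_{i,j}=R_i\Theta_{i,j}\overset{d}{=}\begin{cases} U^{1/(mn)}\dfrac{|\xi_i|^{1/n}}{(\sum_{k=1}^m|\xi_k|^{p/n})^{1/p}}\,\dfrac{\eta_{i,j}}{\lVert(\eta_{i,l})_{l\le n}\rVert_q} & \text{if } p<\infty,\\ |\xi_i|^{1/n}\,\dfrac{\eta_{i,j}}{\lVert(\eta_{i,l})_{l\le n}\rVert_q} & \text{if } p=\infty,\end{cases}$$ where $U,\xi_1,\dots,\xi_m,\eta_{1,1},\dots,\eta_{m,n}$ are independent with the distributions given in (a) and (b).
   Context: For $p\in(0,\infty]$, $\lVert x\rVert_p=(\sum_{i}|x_i|^p)^{1/p}$ if $p<\infty$ and $\lVert x\rVert_\infty=\max_i|x_i|$ on $\mathbb{R}^n$; $\mathbb{B}_p^n$ and $\mathbb{S}_p^{n-1}$ are the corresponding closed unit ball and unit sphere in $\mathbb{R}^n$, and $\omega_p^n$ is the Lebesgue volume of $\mathbb{B}_p^n$. For $x=(x_{i,j})_{i\le m,j\le n}\in\mathbb{R}^{m\times n}$, $\lVert x\rVert_{p,q}:=\bigl\lVert\bigl(\lVert(x_{i,j})_{j\le n}\rVert_q\bigr)_{i\le m}\bigr\rVert_p$ and $\mathbb{B}_{p,q}^{m,n}:=\{x\in\mathbb{R}^{m\times n}:\lVert x\rVert_{p,q}\le1\}$. Uniform distribution means with respect to $mn$-dimensional Lebesgue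 measure. The (normalized) cone measure on $\mathbb{S}_q^{n-1}$ is $\kappa_q^{n-1}(A):=\mathrm{vol}_n(\{sa:s\in[0,1],a\in A\})/\omega_q^n$ for Borel $A\subset\mathbb{S}_q^{n-1}$. The $p$-Gaussian distribution is the probability measure on $\mathbb{R}$ with Lebesgue density $\frac{1}{2p^{1/p}\Gamma(1/p+1)}e^{-|x|^p/p}$ if $p<\infty$, and $\frac12\mathbf{1}_{[-1,1]}(x)$ if $p=\infty$. For $p=\infty$, $p/n:=\infty$. $\overset{d}{=}$ denotes equality in distribution. *)

(* Defs.v *)
From HB Require Import structures.
From mathcomp Require Import all_boot all_order all_algebra.
From mathcomp Require Import all_classical all_reals all_analysis.

Set Implicit Arguments.
Unset Strict Implicit.
Unset Printing Implicit Defensive.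
Import Order.TTheory GRing.Theory Num.Theory.
Import numFieldNormedType.Exports.
Local Open Scope classical_set_scope.
Local Open Scope ring_scope.

Section tuple_measure.
Context d (T : measurableType d) (R : realType).

Definition cons_pair n (z : T * n.-tuple T) : n.+1.-tuple T :=
  [the n.+1.-tuple T of z.1 :: z.2].

Lemma measurable_cons_pair n : measurable_fun [set: T * n.-tuple T] (@cons_pair n).
Proof. exact: measurable_cons. Qed.

Section step.
Variables (mu : {sigma_finite_measure set T -> \bar R}) (n : nat).
Variable nu : {sigma_finite_measure set (n.-tuple T) -> \bar R}.

Definition tuple_measureS : set (n.+1.-tuple T) -> \bar R :=
  pushforward (mu \x nu)%E (@cons_pair n).

Let preimage_measurable A : measurable A -> measurable (@cons_pair n @^-1` A).
Proof. by move=> mA; rewrite -[X in measurable X]setTI; exact: measurable_cons_pair. Qed.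

Let tuple_measureS0 : tuple_measureS set0 = 0%E.
Proof. by rewrite /tuple_measureS /pushforward preimage_set0 measure0. Qed.

Let tuple_measureS_ge0 A : (0 <= tuple_measureS A)%E.
Proof. by rewrite /tuple_measureS /pushforward. Qed.

Let tuple_measureS_sigma_additive : semi_sigma_additive tuple_measureS.
Proof.
move=> F mF tF mUF; rewrite /tuple_measureS /pushforward preimage_bigcup.
apply: measure_semi_sigma_additive.
- by move=> k; exact: preimage_measurable.
- apply/trivIsetP => i j _ _ ij; rewrite -preimage_setI.
  by move/trivIsetP : tF => /(_ _ _ _ _ ij) -> //; rewrite preimage_set0.
- by rewrite -preimage_bigcup; exact: preimage_measurable.
Qed.

HB.instance Definition _ := isMeasure.Build _ _ _ tuple_measureS
  tuple_measureS0 tuple_measureS_ge0 tuple_measureS_sigma_additive.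

Let sigma_finite_tuple_measureS : sigma_finite setT tuple_measureS.
Proof.
have /sigma_finiteP[F [TF ndF Foo]] := sigma_finiteT mu.
have /sigma_finiteP[G [TG ndG Goo]] := sigma_finiteT nu.
pose uncons (t : n.+1.-tuple T) : T * n.-tuple T := (thead t, [tuple of behead t]).
have consK : cancel (@cons_pair n) uncons.
  by case=> x t; congr pair; apply/val_inj.
have muncons : measurable_fun setT uncons.
  apply/measurable_fun_pair; first exact: measurable_tnth.
  exact: measurable_behead.
exists (fun k => uncons @^-1` (F k `*` G k)).
  apply/seteqP; split=> // t _.
  have [k _ Fk] : (\bigcup_k F k) (uncons t).1 by rewrite -TF.
  have [l _ Gl] : (\bigcup_k G k) (uncons t).2 by rewrite -TG.
  exists (maxn k l) => //; split => /=.
    by move: Fk; exact/subsetPset/ndF/leq_maxl.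
  by move: Gl; exact/subsetPset/ndG/leq_maxr.
move=> k; have [mF Fk] := Foo k; have [mG Gk] := Goo k; split.
  by rewrite -[X in measurable X]setTI; apply: muncons => //; exact: measurableX.
rewrite /tuple_measureS /pushforward -comp_preimage.
rewrite (_ : uncons \o _ = id); last by apply/funext => z /=; rewrite consK.
by rewrite preimage_id product_measure1E// lte_mul_pinfty// ge0_fin_numE.
Qed.

HB.instance Definition _ :=
  @Measure_isSigmaFinite.Build _ _ _ tuple_measureS sigma_finite_tuple_measureS.

End step.

Fixpoint tuple_measure (mu : {sigma_finite_measure set T -> \bar R}) (n : nat) :
    {sigma_finite_measure set (n.-tuple T) -> \bar R} :=
  match n with
  | 0 => \d_([tuple] : 0.-tuple T)
  | n'.+1 => tuple_measureS mu (tuple_measure mu n')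
  end.

Lemma tuple_measure_box (mu : {sigma_finite_measure set T -> \bar R}) n
    (A : 'I_n -> set T) : (forall i, measurable (A i)) ->
  tuple_measure mu n [set t | forall i, A i (tnth t i)] = (\prod_i mu (A i))%E.
Proof.
elim: n A => [|n IHn] A mA /=.
  by rewrite big_ord0 diracE mem_set // => -[].
set B := [set t : n.-tuple T | forall i, A (lift ord0 i) (tnth t i)].
have mB : measurable B.
  rewrite (_ : B = \bigcap_i ((fun t : n.-tuple T => tnth t i) @^-1` A (lift ord0 i))).
    apply: fin_bigcap_measurable => // i _; rewrite -[X in measurable X]setTI.
    exact: measurable_tnth.
  by apply/seteqP; split=> t /= H i //=; exact: H.
rewrite big_ord_recl /tuple_measureS /pushforward (_ : _ @^-1` _ = A ord0 `*` B).
  by rewrite product_measure1E//; congr (_ * _)%E; exact: IHn.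
apply/seteqP; split=> -[x t] /=.
  by move=> H; split=> [|i]; [exact: (H ord0)|have := H (lift ord0 i); rewrite tnthS].
case=> Hx Ht i; case: (unliftP ord0 i) => [j ->|-> //].
by rewrite tnthS; exact: Ht.
Qed.

End tuple_measure.

(* lebesgue_measure is declared on measurableTypeR R; this is the same function
   on the Borel measurableType structure carried by R itself, from which the
   structures of n.-tuple R and of real random variables are inferred. *)
Section lebesgue_real.
Variable R : realType.

Definition lebesgue_real : set R -> \bar R := @lebesgue_measure R.

HB.instance Definition _ := isMeasure.Build _ R R lebesgue_real
  (measure0 (@lebesgue_measure R)) (measure_ge0 (@lebesgue_measure R))
  (@measure_semi_sigma_additive _ _ _ (@lebesgue_measure R)).

HB.instance Definition _ := @Measure_isSigmaFinite.Build _ R R lebesgue_real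
  (sigma_finiteT (@lebesgue_measure R)).

End lebesgue_real.

Section distributions.
Context d (T : measurableType d) (R : realType).
Implicit Types (mu P : set T -> \bar R).

Definition uniform_on mu (B : set T) : set T -> \bar R :=
  fun A => (mu (A `&` B) / mu B)%E.

Definition has_density d' (S : measurableType d') P (f : T -> S)
    (nu : set S -> \bar R) (g : S -> R) : Prop :=
  forall A : set S, measurable A ->
    pushforward P f A = (\int[nu]_(x in A) (g x)%:E)%E.

Definition eq_dist d' (T' : measurableType d') d'' (S : measurableType d'')
    P (f : T -> S) (P' : set T' -> \bar R) (g : T' -> S) : Prop :=
  forall A : set S, measurable A -> pushforward P f A = pushforward P' g A.

(* Independence of set systems, so that random variables with values in
   different spaces can be put in one family through the sigma-algebras
   g_sigma_algebra_preimage they generate. Sigma-algebras contain setT, so the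
   product rule over the whole finite family entails it over subfamilies. *)
Definition mutually_independent (I : finType) P (F : I -> set (set T)) : Prop :=
  forall E : I -> set T, (forall i, F i (E i)) ->
    P (\bigcap_i E i) = (\prod_(i : I) P (E i))%E.

End distributions.

Section lp.
Variable R : realType.
Implicit Types (p q : \bar R) (m n : nat).

(* Exponents range over ]0, +oo]; the value at -oo is irrelevant. *)
Definition lpnorm p n (x : n.-tuple R) : R :=
  match p with
  | r%:E => (\sum_(i < n) `|tnth x i| `^ r) `^ r^-1
  | _ => \big[Num.max/0]_(i < n) `|tnth x i|
  end.

Definition lpball p n : set (n.-tuple R) := [set x | lpnorm p x <= 1].
Arguments lpball : clear implicits.

Definition lpsphere p n : set (n.-tuple R) := [set x | lpnorm p x = 1].
Arguments lpsphere : clear implicits.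

Definition row_norms q m n (x : m.-tuple (n.-tuple R)) : m.-tuple R :=
  [tuple lpnorm q (tnth x i) | i < m].

Definition mixed_norm p q m n (x : m.-tuple (n.-tuple R)) : R :=
  lpnorm p (row_norms q x).

Definition mixed_ball p q m n : set (m.-tuple (n.-tuple R)) :=
  [set x | mixed_norm p q x <= 1].
Arguments mixed_ball : clear implicits.

Definition normalize q n (x : n.-tuple R) : n.-tuple R :=
  [tuple tnth x j / lpnorm q x | j < n].

Definition lebesgue_tuple n := tuple_measure (@lebesgue_real R) n.

Definition lebesgue_array m n := tuple_measure (lebesgue_tuple n) m.

Definition lpball_volume p n : \bar R := lebesgue_tuple n (lpball p n).

Definition cone n (A : set (n.-tuple R)) : set (n.-tuple R) :=
  [set [tuple s * tnth a j | j < n] | s in `[0, 1] & a in A].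

Definition cone_measure q n (A : set (n.-tuple R)) : \bar R :=
  (lebesgue_tuple n (cone A) / lpball_volume q n)%E.

Definition Gamma (s : R) : R :=
  \int[lebesgue_measure]_(t in `]0%R, +oo[) (t `^ (s - 1) * expR (- t)).

Definition pgaussian_pdf p (x : R) : R :=
  match p with
  | r%:E => (2 * r `^ r^-1 * Gamma (r^-1 + 1))^-1 * expR (- (`|x| `^ r / r))
  | _ => 2^-1 * \1_(`[-1, 1]%classic) x
  end.

(* (p / n%:R%:E)%E is +oo when p = +oo and 0 < n. *)
Definition radial_pdf p m n (r : m.-tuple R) : R :=
  (2 * n%:R) ^+ m / fine (lpball_volume (p / n%:R%:E)%E m)
  * \prod_(i < m) tnth r i ^+ n.-1
  * \1_(lpball p m `&` [set r | forall i, 0 <= tnth r i]) r.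

Definition radial_rep p m n (u : R) (z : 'I_m -> R) : m.-tuple R :=
  match p with
  | r%:E => [tuple u `^ (m * n)%:R^-1 *
               (`|z i| `^ n%:R^-1
                / (\sum_(k < m) `|z k| `^ (r / n%:R)) `^ r^-1) | i < m]
  | _ => [tuple `|z i| `^ n%:R^-1 | i < m]
  end.

Definition angular_rep q n (y : 'I_n -> R) : n.-tuple R :=
  normalize q [tuple y j | j < n].

Definition array_rep p q m n (u : R) (z : 'I_m -> R) (y : 'I_m -> 'I_n -> R) :
    m.-tuple (n.-tuple R) :=
  [tuple [tuple tnth (radial_rep p n u z) i * tnth (angular_rep q (y i)) j
         | j < n] | i < m].

Section inputs.
Context d (T : measurableType d) (P : probability T R).

Definition uniform01 (U : {RV P >-> R}) : Prop :=
  forall A, measurable A -> distribution P U A = uniform_prob (@ltr01 R) A.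

Definition pgaussian p (X : {RV P >-> R}) : Prop :=
  has_density P X (@lebesgue_real R) (pgaussian_pdf p).

Definition radial_input p m n (U : {RV P >-> R}) (xi : 'I_m -> {RV P >-> R}) :
    Prop :=
  [/\ mutually_independent P (fun o : option 'I_m =>
        g_sigma_algebra_preimage (if o is Some i then xi i else U)),
      uniform01 U
    & forall i, pgaussian (p / n%:R%:E)%E (xi i)].

Definition angular_input q m n (eta : 'I_m -> 'I_n -> {RV P >-> R}) : Prop :=
  mutually_independent P (fun ij : 'I_m * 'I_n =>
    g_sigma_algebra_preimage (eta ij.1 ij.2))
  /\ forall i j, pgaussian q (eta i j).

Definition joint_input p q m n (U : {RV P >-> R}) (xi : 'I_m -> {RV P >-> R})
    (eta : 'I_m -> 'I_n -> {RV P >-> R}) : Prop :=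
  [/\ mutually_independent P (fun o : option ('I_m + 'I_m * 'I_n) =>
        g_sigma_algebra_preimage
          (match o with
           | None => U
           | Some (inl i) => xi i
           | Some (inr ij) => eta ij.1 ij.2
           end)),
      uniform01 U,
      forall i, pgaussian (p / n%:R%:E)%E (xi i)
    & forall i j, pgaussian q (eta i j)].

End inputs.
End lp.

Arguments lpball {R} p n.
Arguments lpsphere {R} p n.
Arguments mixed_ball {R} p q m n.
Arguments radial_pdf {R} p m n r.

(* Main.v *)
(** The map [x |-> (N x, x / N x)], [N] the [l_q]-norm on [R^n], turns Lebesgue
measure into a product: by scaling, [{N <= r, x / N x \in B}] has volume [r^n]
times that of [{N <= 1, x / N x \in B}]. Up to a constant the radial factor is
the image of Lebesgue measure on the line under [x |-> |x|^(1/n)], which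
also has distribution function proportional to [r^n]. Applying this row by row,
the radii of a uniform point of the mixed ball are the image of a uniform point of
the [l_(p/n)]-ball of [R^m] under the coordinatewise map [|.|^(1/n)], and are
independent of the directions, whose law is the cone measure.

A [q]-Gaussian vector has a density depending on its [l_q]-norm only, so its
direction follows the cone measure as well; multiplied by [U^(1/m)], a
[p/n]-Gaussian direction in [R^m] becomes a uniform point of the [l_(p/n)]-ball.

Laws are compared on pi-systems of boxes and rectangles, which avoids any
change of variables in several dimensions. *)
Require Import Defs.
From HB Require Import structures.
From mathcomp Require Import all_boot all_order all_algebra.
From mathcomp Require Import all_classical all_reals all_analysis.
From mathcomp Require Import measurable_realfun.
From mathcomp Require Import ring.

Set Implicit Arguments.
Unset Strict Implicit.
Unset Printing Implicit Defensive.
Import Order.TTheory GRing.Theory Num.Theory.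
Import numFieldNormedType.Exports.
Local Open Scope classical_set_scope.
Local Open Scope ring_scope.

(** * Uniqueness of measures on spaces of tuples *)

(** Volumes of balls are never evaluated: they cancel between numerator and denominator, or are
    fixed by a total mass equal to one. Only the Gaussian constant has to be computed; since [Gamma]
    is the real part of an extended integral, this includes showing that the integral is finite and
    positive. For exponents below 1 the triangle inequality fails. The norms are therefore used only
    through homogeneity and through comparison with the coordinates, which encloses each ball
    between two cubes. The representations are claimed for inputs on an arbitrary probability space.
    The joint law of the inputs is first identified with a product measure on a concrete space of
    tuples, where all computations take place; the same product measure shows that such inputs
    exist. Since division by 0 gives 0, the zero vector has direction 0, and a vector is always its
    norm times its direction. Null sets matter only for the almost sure claim and for the comparison
    of sectors with cones. *)

Definition box T n (A : 'I_n -> set T) : set (n.-tuple T) :=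
  [set t | forall i, A i (tnth t i)].

Definition boxes T n (G : set (set T)) : set (set (n.-tuple T)) :=
  [set box A | A in [set A : 'I_n -> set T | forall i, G (A i)]].
Arguments boxes {T} n G.

Definition rects S T (G : set (set S)) (H : set (set T)) : set (set (S * T)) :=
  [set A | exists2 B, G B & exists2 C, H C & A = B `*` C].
Arguments rects {S T} G H.

(** With [setT] in the family, finite measures are compared without an exhausting sequence, and a
    condition on one coordinate is itself a box or a rectangle. *)
Record pi_generator d (T : measurableType d) (G : set (set T)) : Prop :=
  PiGenerator {
    pi_measurable : G `<=` measurable;
    pi_setI : setI_closed G;
    pi_setT : G setT;
    pi_generates : measurable `<=` <<s G >> }.

Lemma pi_generator_measurable d (T : measurableType d) :
  pi_generator (@measurable d T).
Proof.
by split=> // A B; exact: measurableI.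
Qed.

Lemma measurable_box d (T : measurableType d) n (A : 'I_n -> set T) :
  (forall i, measurable (A i)) -> measurable (box A).
Proof.
move=> mA; rewrite (_ : box A =
    \bigcap_i ((fun t : n.-tuple T => tnth t i) @^-1` A i)).
  apply: fin_bigcap_measurable => // i _; rewrite -[X in measurable X]setTI.
  exact: measurable_tnth.
by apply/seteqP; split=> t /= H i //=; exact: H.
Qed.

Lemma boxI T n (A B : 'I_n -> set T) :
  box A `&` box B = box (fun i => A i `&` B i).
Proof.
apply/seteqP; split=> t /=; first by case=> tA tB i; split; [exact: tA|exact: tB].
by move=> tAB; split=> i; have [] := tAB i.
Qed.

Lemma boxT T n : box (fun _ : 'I_n => [set: T]) = setT.
Proof. by apply/seteqP; split. Qed.

Lemma pi_generator_boxes d (T : measurableType d) n (G : set (set T)) :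
  pi_generator G -> pi_generator (boxes n G).
Proof.
case=> Gm GI GT Gs; split.
- by move=> _ [A GA <-]; apply: measurable_box => i; exact/Gm/GA.
- move=> _ _ [A GA <-] [B GB <-]; rewrite boxI; exists (fun i => A i `&` B i) => //.
  by move=> i; exact: GI.
- by exists (fun=> setT); rewrite ?boxT.
(* The product sigma-algebra is the smallest one that makes the coordinates measurable, so it
   suffices that they are measurable for the sigma-algebra of boxes: the identity is then measurable
   between the two structures. *)
- have mid : measurable_fun [set: g_sigma_algebraType (boxes n G)]
      (id : g_sigma_algebraType (boxes n G) -> n.-tuple T).
    apply/measurable_fun_tnthP => i; apply: (measurability G).
      apply/seteqP; split=> //; apply: smallest_sub => //.
      exact: sigma_algebra_measurable.
    move=> _ [A GA <-]; rewrite setTI; apply: sub_sigma_algebra.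
    exists (fun j => if j == i then A else setT).
      by move=> j; case: ifP.
    apply/seteqP; split=> t /=; first by move=> /(_ i); rewrite eqxx.
    by move=> At j; case: eqP => // ->.
  by move=> A mA; have := mid measurableT A mA; rewrite setTI.
Qed.

Lemma pi_generator_rects d d' (S : measurableType d) (T : measurableType d')
    (G : set (set S)) (H : set (set T)) :
  pi_generator G -> pi_generator H -> pi_generator (rects G H).
Proof.
case=> Gm GI GT Gs [Hm HI HT Hs]; split.
- by move=> _ [A GA [B HB ->]]; apply: measurableX; [exact: Gm|exact: Hm].
- move=> _ _ [A GA [B HB ->]] [C GC [D HD ->]]; rewrite -setXI.
  by exists (A `&` C); [exact: GI|exists (B `&` D) => //; exact: HI].
- by exists setT => //; exists setT; rewrite ?setXTT.
- have mid : measurable_fun [set: g_sigma_algebraType (rects G H)]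
      (id : g_sigma_algebraType (rects G H) -> (S * T)%type).
    apply/measurable_fun_pairP; split.
      apply: (measurability G).
        apply/seteqP; split=> //; apply: smallest_sub => //.
        exact: sigma_algebra_measurable.
      move=> _ [A GA <-]; rewrite setTI; apply: sub_sigma_algebra.
      exists A => //; exists setT => //.
      by apply/seteqP; split=> -[x y] //= [].
    apply: (measurability H).
      apply/seteqP; split=> //; apply: smallest_sub => //.
      exact: sigma_algebra_measurable.
    move=> _ [A HA <-]; rewrite setTI; apply: sub_sigma_algebra.
    exists setT => //; exists A => //.
    by apply/seteqP; split=> -[x y] //= [].
  by move=> A mA; have := mid measurableT A mA; rewrite setTI.
Qed.

Lemma pi_generator_unique d (T : measurableType d) (R : realType)
    (G : set (set T)) (m1 m2 : {measure set T -> \bar R}) :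
  pi_generator G -> (m1 setT < +oo)%E -> (forall A, G A -> m1 A = m2 A) ->
  forall A, measurable A -> m1 A = m2 A.
Proof.
case=> Gm GI GT Gs m1T m12 A mA.
apply: (measure_unique G (fun=> setT)) => //.
  apply/seteqP; split=> //; apply: smallest_sub => //.
  exact: sigma_algebra_measurable.
by apply/seteqP; split=> // x _; exists 0%N.
Qed.

(** The version for infinite mass: the cubes over the [F k] exhaust the space. Monotonicity of [F]
    gives the [n] coordinates of a point a common index. *)
Lemma tuple_measure_unique d (T : measurableType d) (R : realType) n
    (F : (set T)^nat) (m1 m2 : {measure set (n.-tuple T) -> \bar R}) :
  (forall k, measurable (F k)) -> nondecreasing_seq F -> \bigcup_k F k = setT ->
  (forall k, m1 (box (fun=> F k)) < +oo)%E ->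
  (forall A : 'I_n -> set T, (forall i, measurable (A i)) ->
    m1 (box A) = m2 (box A)) ->
  forall A, measurable A -> m1 A = m2 A.
Proof.
move=> mF ndF FT m1F m12 A mA.
have [Gm GI GT Gs] := pi_generator_boxes n (pi_generator_measurable T).
apply: (measure_unique (boxes n measurable) (fun k => box (fun=> F k))) => //.
- apply/seteqP; split=> //; apply: smallest_sub => //.
  exact: sigma_algebra_measurable.
- by move=> k; exists (fun=> F k) => // i; exact: mF.
- apply/seteqP; split=> // t _.
  have /choice[k Fk] : forall i, exists k, F k (tnth t i).
    move=> i; have : (\bigcup_k F k) (tnth t i) by rewrite FT.
    by case=> k _ ?; exists k.
  exists (\max_i k i)%N => // i.
  by move: (Fk i); exact/subsetPset/ndF/leq_bigmax.
- by move=> _ [B mB <-]; exact: m12.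
Qed.

(** * Image of a restricted measure *)

Section mpush.
Context d d' (S : measurableType d) (T : measurableType d') (R : realType).
Variables (mu : {measure set S -> \bar R}) (f : S -> T) (D : set S).
Hypotheses (mf : measurable_fun setT f) (mD : measurable D).

(** The two proofs are arguments so that the measure structure can be inferred from the term
    alone. *)
Definition mpush (_ : measurable_fun setT f) (_ : measurable D) (A : set T) :
  \bar R := mu (f @^-1` A `&` D).

Let mpush0 : mpush mf mD set0 = 0%E.
Proof. by rewrite /mpush preimage_set0 set0I. Qed.

Let mpush_ge0 A : (0 <= mpush mf mD A)%E.
Proof. exact: measure_ge0. Qed.

Let mpush_sigma_additive : semi_sigma_additive (mpush mf mD).
Proof.
move=> F mFi tF mUF.
exact: (@measure_semi_sigma_additive _ _ _ (pushforward (mrestr mu mD) f)).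
Qed.

HB.instance Definition _ := isMeasure.Build _ _ _ (mpush mf mD)
  mpush0 mpush_ge0 mpush_sigma_additive.

End mpush.

(** * The [l_q] norm *)

Section lp_norm.
Variables (R : realType).
Implicit Types (q : \bar R) (n : nat).

Lemma lpnorm_ge0 q n (x : n.-tuple R) : 0 <= lpnorm q x.
Proof.
case: q => [r||] /=; first exact: powR_ge0.
  by elim/big_ind : _ => // a b a0 b0; rewrite le_max a0.
by elim/big_ind : _ => // a b a0 b0; rewrite le_max a0.
Qed.

Lemma measurable_lpnorm q n : measurable_fun setT (@lpnorm R q n).
Proof.
have mc i : measurable_fun setT (fun x : n.-tuple R => `|tnth x i|).
  by apply: measurableT_comp => //; exact: measurable_tnth.
have mmax : measurable_fun setT
    (fun x : n.-tuple R => \big[Num.max/0]_(i < n) `|tnth x i|).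
  elim: (index_enum _) => [|i s IHs].
    by under eq_fun do rewrite big_nil; exact: measurable_cst.
  by under eq_fun do rewrite big_cons; exact: measurable_maxr.
case: q => [r||] //=; apply: (measurableT_comp (measurable_powR _)).
apply: measurable_sum => i; exact: (measurableT_comp (measurable_powR _)).
Qed.

(** Monotonicity of powers is enough: [|x_i|] is the root of one summand. Hence balls lie in cubes,
    for exponents below 1 as well. *)
Lemma le_lpnorm q n (x : n.-tuple R) i :
  (0 < q)%E -> `|tnth x i| <= lpnorm q x.
Proof.
case: q => [r||] //= r0; last exact: (le_bigmax _ (fun i => `|tnth x i|)).
rewrite lte_fin in r0.
rewrite -[leLHS]powRr1// -[X in _ `^ X](divff (lt0r_neq0 r0)) powRrM.
apply: ge0_ler_powR; rewrite ?nnegrE ?invr_ge0 ?powR_ge0 ?(ltW r0)//.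
  by apply: sumr_ge0 => j _; exact: powR_ge0.
by rewrite (bigD1 i)//= lerDl sumr_ge0// => j _; exact: powR_ge0.
Qed.

Definition scale_tuple n (s : R) (x : n.-tuple R) : n.-tuple R :=
  [tuple s * tnth x j | j < n].

Lemma lpnorm_scale q n s (x : n.-tuple R) :
  (0 < q)%E -> 0 <= s -> lpnorm q (scale_tuple s x) = s * lpnorm q x.
Proof.
move=> q0 s0.
have sE i : `|tnth (scale_tuple s x) i| = s * `|tnth x i|.
  by rewrite tnth_mktuple normrM ger0_norm.
case: q q0 => [r||] //= r0; last first.
  under eq_bigr do rewrite sE.
  by rewrite (big_morph ( *%R s) (fun y z => maxr_pMr y z s0) (mulr0 s)).
rewrite lte_fin in r0.
under eq_bigr do rewrite sE powRM//.
rewrite -mulr_sumr powRM ?powR_ge0//; last first.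
  by apply: sumr_ge0 => j _; exact: powR_ge0.
by rewrite -powRrM divff ?gt_eqF// powRr1.
Qed.

Lemma lpnorm_le1 q n : (0 < q)%E -> (0 < n)%N ->
  exists2 c : R, 0 < c & forall x : n.-tuple R,
    (forall i, `|tnth x i| <= c) -> lpnorm q x <= 1.
Proof.
case: q => [r||] //= r0 n0; last first.
  by exists 1 => // x x1; exact: bigmax_le.
rewrite lte_fin in r0; have n0' : 0 < n%:R :> R by rewrite ltr0n.
(* With this [c], each of the [n] summands is at most [c^r = 1/n]. *)
exists (n%:R `^ (- r^-1)); first exact: powR_gt0.
move=> x xc; apply: (@le_trans _ _ (1 `^ r^-1)); last by rewrite powR1.
have s0 : 0 <= \sum_(i < n) `|tnth x i| `^ r.
  by apply: sumr_ge0 => j _; exact: powR_ge0.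
apply: ge0_ler_powR; rewrite ?nnegrE ?invr_ge0 ?(ltW r0)//.
apply: (@le_trans _ _ (\sum_(i < n) n%:R^-1)).
  apply: ler_sum => i _.
  rewrite -[leRHS]powR_inv1 ?(ltW n0')//.
  rewrite (_ : -1 = - r^-1 * r); last by rewrite mulNr mulVf ?gt_eqF.
  rewrite powRrM.
  by apply: ge0_ler_powR; rewrite ?nnegrE ?(ltW r0) ?powR_ge0.
by rewrite sumr_const card_ord -[leLHS]mulr_natr mulVf// gt_eqF.
Qed.

Lemma measurable_normalize q n : measurable_fun setT (@normalize R q n).
Proof.
(* Division becomes a real power with exponent -1, which is measurable on the whole line, the value
   0 of the norm included. *)
apply/measurable_fun_tnthP => i; rewrite (_ : _ \o _ =
    fun x => tnth x i * (lpnorm q x) `^ (-1)); last first.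
  by apply/funext => x /=; rewrite tnth_mktuple powR_inv1// lpnorm_ge0.
apply: measurable_funM; first exact: measurable_tnth.
by apply: (measurableT_comp (measurable_powR _)); exact: measurable_lpnorm.
Qed.

Lemma measurable_scale_tuple n s : measurable_fun setT (@scale_tuple n s).
Proof.
apply/measurable_fun_tnthP => i.
rewrite (_ : _ \o _ = fun x => s * tnth x i).
  by apply: measurable_funM => //; exact: measurable_tnth.
by apply/funext => x /=; rewrite tnth_mktuple.
Qed.

Lemma normalize_scale q n s (x : n.-tuple R) : (0 < q)%E -> 0 < s ->
  normalize q (scale_tuple s x) = normalize q x.
Proof.
move=> q0 s0; apply/eq_from_tnth => i; rewrite !tnth_mktuple.
by rewrite lpnorm_scale ?ltW// -mulf_div divff ?mul1r// gt_eqF.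
Qed.

(* Also true at [x = 0], where [normalize] returns 0. *)
Lemma scale_normalize q n (x : n.-tuple R) : (0 < q)%E ->
  scale_tuple (lpnorm q x) (normalize q x) = x.
Proof.
move=> q0; apply/eq_from_tnth => i; rewrite !tnth_mktuple.
have [N0|N0] := eqVneq (lpnorm q x) 0; last by rewrite mulrCA divff ?mulr1.
have := le_lpnorm x i q0; rewrite N0 normr_le0 => /eqP ->.
by rewrite !mul0r.
Qed.

End lp_norm.

(** * Scaling of Lebesgue measure *)

Section radial_measure.
Variable R : realType.
Implicit Types n : nat.

Definition rays : set (set R) := [set A | exists r : R, A = `]-oo, r]%classic].

(** A measure is determined by its distribution function. Finiteness is asked on left rays only,
    because images of Lebesgue measure under a norm or under [root_abs] have infinite total mass. *)
Lemma ray_unique (m1 m2 : {measure set R -> \bar R}) :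
  (forall r : R, m1 `]-oo, r]%classic < +oo)%E ->
  (forall r : R, m1 `]-oo, r]%classic = m2 `]-oo, r]%classic) ->
  forall A, measurable A -> m1 A = m2 A.
Proof.
move=> m1y m12 A mA.
apply: (measure_unique rays (fun k => `]-oo, k%:R]%classic)) => //.
- rewrite [LHS](RGenOInfty.measurableE R); apply/seteqP; split.
    apply: smallest_sub; first exact: smallest_sigma_algebra.
    move=> _ [x ->]; rewrite -setCitvl.
    apply: (@measurableC _ (g_sigma_algebraType rays)).
    by apply: sub_sigma_algebra; exists x.
  apply: smallest_sub; first exact: smallest_sigma_algebra.
  move=> _ [x ->]; rewrite -setCitvr.
  by apply: measurableC; exact: RGenOInfty.measurable_itv_bnd_infty.
- move=> _ _ [x ->] [y ->]; exists (Num.min x y).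
  by apply/seteqP; split => z /=; rewrite !in_itv/= le_min;
    [case=> -> -> | move/andP].
- by move=> k; exists k%:R.
- apply/seteqP; split=> // x _.
  exists (Num.truncn `|x|).+1 => //=; rewrite in_itv/=.
  by rewrite (le_trans (ler_norm x))// ltW// truncnS_gt.
- by move=> _ [r ->].
Qed.

(* For [n > 0], its image of Lebesgue measure gives [(-oo, r]] mass [2 r^n]; up to a
   factor this is the law of the norm under Lebesgue measure on [R^n]. *)
Definition root_abs n (x : R) : R := `|x| `^ n%:R^-1.

Lemma measurable_root_abs n : measurable_fun setT (root_abs n).
Proof. by apply: (measurableT_comp (measurable_powR _)). Qed.

Lemma root_abs_le n x r : (0 < n)%N -> 0 <= r ->
  (root_abs n x <= r) = (`|x| <= r ^+ n).
Proof.
move=> n0 r0; have n0' : 0 < n%:R :> R by rewrite ltr0n.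
have xE : `|x| = root_abs n x ^+ n.
  rewrite -powR_mulrn ?powR_ge0// -powRrM mulVf ?gt_eqF// powRr1//.
by rewrite [in RHS]xE ler_pXn2r// ?nnegrE ?powR_ge0.
Qed.

Lemma lebesgue_root_abs n r : (0 < n)%N -> 0 <= r ->
  lebesgue_real (root_abs n @^-1` `]-oo, r]%classic) = (2 * r ^+ n)%:E.
Proof.
move=> n0 r0; rewrite (_ : _ @^-1` _ = `[- r ^+ n, r ^+ n]%classic).
  rewrite /lebesgue_real lebesgue_measure_itv/= lte_fin.
  case: ltP => h; first by rewrite -EFinD opprK mulr_natl mulr2n.
  have : r ^+ n = 0.
    apply/le_anti; rewrite exprn_ge0// andbT.
    by rewrite -(@pmulr_rle0 _ 2)// mulr_natl mulr2n -lerBrDr sub0r.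
  by move=> ->; rewrite mulr0.
by apply/seteqP; split=> x /=; rewrite !in_itv/= root_abs_le// ler_norml.
Qed.

Lemma lebesgue_root_abs_lt0 n r : r < 0 ->
  lebesgue_real (root_abs n @^-1` `]-oo, r]%classic) = 0%E.
Proof.
move=> r0; rewrite (_ : _ @^-1` _ = set0) ?measure0//.
apply/seteqP; split=> x //=; rewrite in_itv/= => xr.
by have := le_lt_trans xr r0; rewrite ltNge powR_ge0.
Qed.

End radial_measure.

Section lebesgue_tuple_theory.
Variable R : realType.
Implicit Types (n : nat) (q : \bar R).

Lemma lebesgue_tuple_box n (A : 'I_n -> set R) :
  (forall i, measurable (A i)) ->
  lebesgue_tuple R n (box A) = (\prod_i lebesgue_real (A i))%E.
Proof. exact: tuple_measure_box. Qed.

Lemma nd_centered_itv :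
  nondecreasing_seq (fun k => `[- k%:R, k%:R]%classic : set R).
Proof.
move=> k l kl; apply/subsetPset => x /=; rewrite !in_itv/= => /andP[kx xk].
by rewrite (le_trans _ kx) ?(le_trans xk)// ?lerN2 ler_nat.
Qed.

Lemma bigcup_centered_itv : \bigcup_k `[- k%:R, k%:R]%classic = [set: R].
Proof.
apply/seteqP; split=> // x _; exists (Num.truncn `|x|).+1 => //=.
by rewrite in_itv/= -ler_norml ltW// truncnS_gt.
Qed.

Lemma lebesgue_real_itv (a b : R) : a <= b ->
  lebesgue_real `[a, b]%classic = (b - a)%:E.
Proof.
rewrite /lebesgue_real lebesgue_measure_itv/= lte_fin le_eqVlt.
by case/predU1P => [->|ab]; rewrite ?ltxx ?subrr// ab.
Qed.

Lemma lebesgue_tuple_centered n (c : R) : 0 <= c ->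
  lebesgue_tuple R n (box (fun=> `[- c, c]%classic)) = ((2 * c) ^+ n)%:E.
Proof.
move=> c0; rewrite lebesgue_tuple_box//.
rewrite (eq_bigr (fun=> (2 * c)%:E)); last first.
  by move=> i _; rewrite lebesgue_real_itv ?ge0_cp// opprK mulr_natl mulr2n.
by rewrite prodEFin prodr_const card_ord.
Qed.

Lemma lebesgue_tuple_unique n (m : {measure set (n.-tuple R) -> \bar R}) :
  (forall A : 'I_n -> set R, (forall i, measurable (A i)) ->
    m (box A) = (\prod_i lebesgue_real (A i))%E) ->
  forall A, measurable A -> lebesgue_tuple R n A = m A.
Proof.
move=> mE; apply: (@tuple_measure_unique _ R R n
  (fun k => `[- k%:R, k%:R]%classic) (lebesgue_tuple R n) m) => //.
- exact: nd_centered_itv.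
- exact: bigcup_centered_itv.
- by move=> k /=; rewrite lebesgue_tuple_centered// ltry.
- by move=> A mA; rewrite mE//; exact: lebesgue_tuple_box.
Qed.

(** Both sides are measures in [A], and they agree on the half-open intervals that characterize
    [lebesgue_measure]. *)
Lemma lebesgue_realM (s : R) (A : set R) : 0 < s -> measurable A ->
  lebesgue_real A = (s%:E * lebesgue_real ( *%R s @^-1` A))%E.
Proof.
move=> s0 mA.
have ms : @measurable_fun _ _ (measurableTypeR R) (measurableTypeR R) setT ( *%R s).
  exact: (@measurable_funM _ R R setT (cst s) id).
pose sn : {nonneg R} := NngNum (ltW s0).
pose m := mscale sn (mpush (@lebesgue_measure R) ms measurableT).
have mE B : m B = (s%:E * lebesgue_real ( *%R s @^-1` B))%E.
  by rewrite -[X in lebesgue_real X]setIT.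
suff leb_m : forall X, ocitv X -> lebesgue_measure X = m X.
  by rewrite {1}/lebesgue_real (lebesgue_measure_unique leb_m)// mE.
move=> _ [[a b] _ <-]; rewrite mE /lebesgue_real.
rewrite (_ : *%R s @^-1` _ = `]a / s, b / s]%classic); last first.
  apply/seteqP; split=> x /=; rewrite !in_itv/=.
    by rewrite ltr_pdivrMr// ler_pdivlMr// mulrC.
  by rewrite ltr_pdivrMr// ler_pdivlMr// mulrC.
rewrite !lebesgue_measure_itv/= !lte_fin ltr_pM2r ?invr_gt0//.
case: ifP => _; last by rewrite mule0.
by rewrite -!EFinD -EFinM -mulrBl mulrC divfK// gt_eqF.
Qed.

(** On a box every coordinate contributes one factor [s]; uniqueness on boxes does the rest. *)
Lemma lebesgue_tuple_scale n (s : R) (A : set (n.-tuple R)) : 0 < s ->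
  measurable A ->
  lebesgue_tuple R n A =
    ((s ^+ n)%:E * lebesgue_tuple R n (@scale_tuple R n s @^-1` A))%E.
Proof.
move=> s0 mA; have sn0 : 0 <= s ^+ n by rewrite exprn_ge0// ltW.
pose m := mscale (NngNum sn0)
  (mpush (lebesgue_tuple R n) (@measurable_scale_tuple R n s) measurableT).
have mE B : m B =
    ((s ^+ n)%:E * lebesgue_tuple R n (@scale_tuple R n s @^-1` B))%E.
  by rewrite -[X in lebesgue_tuple R n X]setIT.
apply: (etrans (@lebesgue_tuple_unique n m _ _ _)) => //.
move=> B mB; apply: (etrans (mE _)).
rewrite (_ : _ @^-1` _ = box (fun i => *%R s @^-1` B i)); last first.
  apply/seteqP; split=> t /= H i; first by have := H i; rewrite tnth_mktuple.
  by rewrite tnth_mktuple; exact: H.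
rewrite lebesgue_tuple_box; last first.
  move=> i; rewrite -[X in measurable X]setTI.
  by apply: (@measurable_funM _ R R setT (cst s) id).
transitivity (\prod_(i < n) (s%:E * lebesgue_real ( *%R s @^-1` B i)))%E.
  by rewrite big_split/= prodEFin prodr_const card_ord.
by apply: eq_bigr => i _; rewrite -lebesgue_realM.
Qed.

End lebesgue_tuple_theory.

(** * Polar decomposition *)

Section polar.
Variable R : realType.
Variables (q : \bar R) (n : nat).
Hypotheses (q0 : (0 < q)%E) (n0 : (0 < n)%N).

(** Up to the origin, this is the cone over the part of [B] on the sphere. As a preimage, unlike the
    cone, it is visibly measurable. *)
Definition sector (B : set (n.-tuple R)) : set (n.-tuple R) :=
  lpball q n `&` @normalize R q n @^-1` B.

Lemma measurable_lpball : measurable (lpball q n : set (n.-tuple R)).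
Proof.
rewrite (_ : lpball q n = @lpnorm R q n @^-1` `]-oo, 1]%classic); last first.
  by apply/seteqP; split => x /=; rewrite in_itv.
by rewrite -[X in measurable X]setTI; exact: measurable_lpnorm.
Qed.

Lemma measurable_preimage_normalize (B : set (n.-tuple R)) :
  measurable B -> measurable (@normalize R q n @^-1` B).
Proof.
by move=> mB; rewrite -[X in measurable X]setTI; exact: measurable_normalize.
Qed.

Lemma measurable_preimage_lpnorm (A : set R) :
  measurable A -> measurable (@lpnorm R q n @^-1` A).
Proof.
by move=> mA; rewrite -[X in measurable X]setTI; exact: measurable_lpnorm.
Qed.

Lemma measurable_sector (B : set (n.-tuple R)) :
  measurable B -> measurable (sector B).
Proof.
move=> mB; apply: measurableI; first exact: measurable_lpball.
exact: measurable_preimage_normalize.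
Qed.

Lemma lpball_volume_lty : (lpball_volume q n < +oo)%E.
Proof.
apply: (@le_lt_trans _ _ (lebesgue_tuple R n (box (fun=> `[- 1, 1]%classic)))).
  apply: le_measure; rewrite ?inE; first exact: measurable_lpball.
    by apply: measurable_box => i.
  move=> x /= x1 i; rewrite /= in_itv/= -ler_norml.
  exact: le_trans (le_lpnorm x i q0) x1.
by rewrite lebesgue_tuple_centered// ltry.
Qed.

Lemma lpball_volume_gt0 : (0 < lpball_volume q n)%E.
Proof.
have [c c0 cle] := lpnorm_le1 q0 n0.
apply: (@lt_le_trans _ _ (lebesgue_tuple R n (box (fun=> `[- c, c]%classic)))).
  by rewrite lebesgue_tuple_centered ?ltW// lte_fin exprn_gt0// mulr_gt0.
apply: le_measure; rewrite ?inE; first by apply: measurable_box => i.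
  exact: measurable_lpball.
by move=> x /= xc; apply: cle => i; have := xc i; rewrite /= in_itv/= -ler_norml.
Qed.

Lemma lpball_volume_fin_num : lpball_volume q n \is a fin_num.
Proof. by rewrite ge0_fin_numE ?lpball_volume_lty// ltW// lpball_volume_gt0. Qed.

Lemma lpnorm_le0_null (A : set (n.-tuple R)) : measurable A ->
  A `<=` [set x | lpnorm q x <= 0] -> lebesgue_tuple R n A = 0%E.
Proof.
move=> mA A0; apply/eqP; rewrite eq_le measure_ge0 andbT.
(* The origin is seen as a centered cube of half-side 0, whose volume [0 ^+ n] vanishes because [n]
   is positive. *)
apply: (@le_trans _ _ (lebesgue_tuple R n (box (fun=> `[- 0, 0]%classic)))).
  apply: le_measure; rewrite ?inE//; first by apply: measurable_box => i.
  move=> x /A0/= x0 i; rewrite /= in_itv/= -ler_norml.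
  exact: le_trans (le_lpnorm x i q0) x0.
by rewrite lebesgue_tuple_centered// mulr0 expr0n gtn_eqF.
Qed.

(** Directions are invariant under positive scaling, so for [r > 0] the set is [r] times the sector;
    for [r = 0] only the origin can remain. *)
Lemma lebesgue_sector_scale (r : R) (B : set (n.-tuple R)) :
  0 <= r -> measurable B ->
  lebesgue_tuple R n (@lpnorm R q n @^-1` `]-oo, r]%classic `&` @normalize R q n @^-1` B) =
  ((r ^+ n)%:E * lebesgue_tuple R n (sector B))%E.
Proof.
move=> r0 mB.
have mE : measurable (@lpnorm R q n @^-1` `]-oo, r]%classic `&` @normalize R q n @^-1` B).
  apply: measurableI; last exact: measurable_preimage_normalize.
  exact: measurable_preimage_lpnorm.
move: r0; rewrite le_eqVlt => /predU1P[r0|r0].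
  rewrite lpnorm_le0_null// -r0; first by rewrite expr0n gtn_eqF// mul0e.
  by move=> x /=; rewrite in_itv/= => -[].
rewrite (lebesgue_tuple_scale r0)//; congr (_ * lebesgue_tuple R n _)%E.
apply/seteqP; split => x /=; rewrite in_itv/= /lpball/=.
  by rewrite normalize_scale// lpnorm_scale ?(ltW r0)// -ler_pdivlMl// mulVf ?gt_eqF.
by rewrite normalize_scale// lpnorm_scale ?(ltW r0)// -ler_pdivlMl// mulVf ?gt_eqF.
Qed.

Lemma sector_lty (B : set (n.-tuple R)) : measurable B ->
  (lebesgue_tuple R n (sector B) < +oo)%E.
Proof.
move=> mB; apply: (le_lt_trans _ lpball_volume_lty).
apply: le_measure; rewrite ?inE//; first exact: measurable_sector.
  exact: measurable_lpball.
by move=> x [].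
Qed.

(** For fixed [B] both sides are measures in [A] with the same distribution function. The factor 1/2
    compensates the two preimages of a positive radius under [root_abs], which gives the ray up to
    [r] mass [2 r^n]. *)
Lemma polar_decomposition (A : set R) (B : set (n.-tuple R)) :
  measurable A -> measurable B ->
  lebesgue_tuple R n (@lpnorm R q n @^-1` A `&` @normalize R q n @^-1` B) =
  (2^-1%:E * lebesgue_tuple R n (sector B)
    * lebesgue_real (root_abs n @^-1` A))%E.
Proof.
move=> mA mB.
have sBfin : lebesgue_tuple R n (sector B) \is a fin_num.
  by rewrite ge0_fin_numE// sector_lty.
have c0 : 0 <= fine (lebesgue_tuple R n (sector B)) / 2.
  by rewrite divr_ge0// fine_ge0.
pose m1 := mpush (lebesgue_tuple R n) (@measurable_lpnorm R q n)
  (measurable_preimage_normalize mB).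
pose m2 := mscale (NngNum c0)
  (mpush (@lebesgue_real R) (@measurable_root_abs R n) measurableT).
have m2E C : m2 C = (2^-1%:E * lebesgue_tuple R n (sector B)
    * lebesgue_real (root_abs n @^-1` C))%E.
  rewrite -[X in lebesgue_real X]setIT -[X in (_ * X * _)%E]fineK//.
  by rewrite -EFinM [in RHS]mulrC.
rewrite -m2E -[LHS]/(m1 A).
have m1E (r : R) : 0 <= r -> m1 `]-oo, r]%classic =
    ((r ^+ n)%:E * lebesgue_tuple R n (sector B))%E.
  by move=> r0; rewrite -lebesgue_sector_scale.
have m1E0 (r : R) : r < 0 -> m1 `]-oo, r]%classic = 0%E.
  move=> r0; rewrite /m1 /mpush (_ : _ @^-1` _ = set0) ?set0I ?measure0//.
  apply/seteqP; split=> x //=; rewrite in_itv/= => xr.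
  by have := le_lt_trans xr r0; rewrite ltNge lpnorm_ge0.
apply: ray_unique => // r.
  have [r0|r0] := leP 0 r; last by apply: le_lt_trans (ltry 0); rewrite [X in (X <= _)%E]m1E0.
  apply: le_lt_trans (ltry (r ^+ n * fine (lebesgue_tuple R n (sector B)))).
  by rewrite [X in (X <= _)%E]m1E// EFinM fineK.
apply: etrans (esym (m2E _)).
have [r0|r0] := leP 0 r.
  rewrite lebesgue_root_abs//; apply: (etrans (m1E _ r0)).
  rewrite -[X in (_ * X)%E]fineK// -[X in (_ = _ * X * _)%E]fineK//.
  by rewrite -!EFinM; congr EFin; field.
by rewrite lebesgue_root_abs_lt0// mule0; exact: m1E0.
Qed.

(** This is the cone measure of [B] intersected with the sphere, as [cone_measureE] shows. *)
Definition angular_prob (B : set (n.-tuple R)) : \bar R :=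
  (lebesgue_tuple R n (sector B) / lpball_volume q n)%E.

Lemma sector_volume (B : set (n.-tuple R)) : measurable B ->
  lebesgue_tuple R n (sector B) = (lpball_volume q n * angular_prob B)%E.
Proof.
move=> mB; rewrite /angular_prob muleCA divee ?mule1//.
  exact: lpball_volume_fin_num.
by rewrite gt_eqF// lpball_volume_gt0.
Qed.

Lemma angular_prob_fin_num (B : set (n.-tuple R)) : measurable B ->
  angular_prob B \is a fin_num.
Proof.
move=> mB; rewrite fin_numM//; first by rewrite ge0_fin_numE// sector_lty.
rewrite fin_numV//; first by rewrite gt_eqF// lpball_volume_gt0.
by rewrite gt_eqF// (lt_trans _ lpball_volume_gt0).
Qed.

End polar.

Definition root_map (R : realType) n m (t : m.-tuple R) : m.-tuple R :=
  [tuple root_abs n (tnth t i) | i < m].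
Arguments root_map {R} n {m} t.

Section array_polar.
Variable R : realType.
Variables (q : \bar R) (m n : nat).
Hypotheses (q0 : (0 < q)%E) (n0 : (0 < n)%N).

Lemma measurable_root_map : measurable_fun setT (@root_map R n m).
Proof.
apply/measurable_fun_tnthP => i; rewrite (_ : _ \o _ =
    fun t => root_abs n (tnth t i)); last first.
  by apply/funext => t /=; rewrite tnth_mktuple.
apply: (measurableT_comp (@measurable_root_abs R n)); exact: measurable_tnth.
Qed.

Lemma measurable_row_norms : measurable_fun setT (@row_norms R q m n).
Proof.
apply/measurable_fun_tnthP => i; rewrite (_ : _ \o _ =
    fun x => lpnorm q (tnth x i)); last first.
  by apply/funext => x /=; rewrite tnth_mktuple.
apply: (measurableT_comp (@measurable_lpnorm R q n)); exact: measurable_tnth.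
Qed.

Definition directions (B : 'I_m -> set (n.-tuple R)) :
    set (m.-tuple (n.-tuple R)) :=
  box (fun i => @normalize R q n @^-1` B i).

Lemma measurable_directions (B : 'I_m -> set (n.-tuple R)) :
  (forall i, measurable (B i)) -> measurable (directions B).
Proof.
by move=> mB; apply: measurable_box => i; exact: measurable_preimage_normalize.
Qed.

(** When [A] is a box, the set is a product over the rows and [polar_decomposition] applies to each
    row; uniqueness then extends the equality to every measurable [A]. General sets [A] are needed
    since the radii will be confined to an [l_p]-ball, whereas product sets suffice for the
    directions. *)
Lemma array_polar_decomposition (A : set (m.-tuple R))
    (B : 'I_m -> set (n.-tuple R)) :
  measurable A -> (forall i, measurable (B i)) ->
  lebesgue_array R m n (@row_norms R q m n @^-1` A `&` directions B) =
  ((\prod_i (2^-1%:E * lebesgue_tuple R n (sector q (B i))))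
    * lebesgue_tuple R m (@root_map R n m @^-1` A))%E.
Proof.
move=> mA mB.
have sBfin i : lebesgue_tuple R n (sector q (B i)) \is a fin_num.
  by rewrite ge0_fin_numE// sector_lty.
pose c := \prod_i (2^-1 * fine (lebesgue_tuple R n (sector q (B i)))).
have c0 : 0 <= c by apply: prodr_ge0 => i _; rewrite mulr_ge0// fine_ge0.
have cE : (\prod_i (2^-1%:E * lebesgue_tuple R n (sector q (B i))) = c%:E)%E.
  by rewrite -prodEFin; apply: eq_bigr => i _; rewrite EFinM fineK.
rewrite cE.
pose m1 := mpush (lebesgue_array R m n) measurable_row_norms
  (measurable_directions mB).
pose m2 := mscale (NngNum c0)
  (mpush (lebesgue_tuple R m) measurable_root_map measurableT).
have m2E C :
    m2 C = (c%:E * lebesgue_tuple R m (@root_map R n m @^-1` C))%E.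
  by rewrite -[X in lebesgue_tuple R m X]setIT.
rewrite -m2E -[LHS]/(m1 A).
have m1E C : (forall i, measurable (C i)) -> m1 (box C) =
    (c%:E * \prod_i lebesgue_real (root_abs n @^-1` C i))%E.
  move=> mC; transitivity (lebesgue_array R m n
      (box (fun i => @lpnorm R q n @^-1` C i `&` @normalize R q n @^-1` B i))).
    rewrite /m1 /mpush -boxI; congr (lebesgue_array R m n (_ `&` _)).
    by apply/seteqP; split => x /= H i; have := H i; rewrite tnth_mktuple.
  rewrite /lebesgue_array [LHS]tuple_measure_box; last first.
    move=> i; apply: measurableI; first exact: measurable_preimage_lpnorm.
    exact: measurable_preimage_normalize.
  rewrite -cE -big_split/=; apply: eq_bigr => i _.
  exact: polar_decomposition.
have m2E' C : (forall i, measurable (C i)) -> m2 (box C) =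
    (c%:E * \prod_i lebesgue_real (root_abs n @^-1` C i))%E.
  move=> mC; rewrite m2E -lebesgue_tuple_box; last first.
    by move=> i; rewrite -[X in measurable X]setTI; exact: measurable_root_abs.
  congr (_ * lebesgue_tuple R m _)%E.
  by apply/seteqP; split => x /= H i; have := H i; rewrite tnth_mktuple.
(* Products of left rays have finite mass because both measures are carried by nonnegative radii. *)
apply: (@tuple_measure_unique _ R R m (fun k => `]-oo, k%:R]%classic) m1 m2) => //.
- move=> k l kl; apply/subsetPset => x /=; rewrite !in_itv/= => xk.
  by rewrite (le_trans xk)// ler_nat.
- apply/seteqP; split=> // x _; exists (Num.truncn `|x|).+1 => //=.
  by rewrite in_itv/= (le_trans (ler_norm x))// ltW// truncnS_gt.
- move=> k; rewrite [X in (X < _)%E](m1E (fun=> `]-oo, k%:R]%classic))//.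
  rewrite (eq_bigr (fun=> (2 * k%:R ^+ n)%:E)); last first.
    by move=> i _; rewrite lebesgue_root_abs.
  by rewrite prodEFin -EFinM ltry.
- by move=> C mC; exact: etrans (m1E _ mC) (esym (m2E' _ mC)).
Qed.

End array_polar.

(** * Densities *)

(** The two measures are one function over two measurable structures; the identity map, measurable
    between them, transfers the integral. *)
Lemma ge0_integral_lebesgue_real (R : realType) (A : set R) (f : R -> \bar R) :
  measurable A -> measurable_fun A f -> (forall x, A x -> (0 <= f x)%E) ->
  (\int[@lebesgue_real R]_(x in A) f x = \int[lebesgue_measure]_(x in A) f x)%E.
Proof.
move=> mA mf f0.
have mid : @measurable_fun _ _ (measurableTypeR R) R setT (fun x => x).
  by move=> _ B mB; rewrite setTI.
pose nu := pushforward (@lebesgue_measure R) (fun x : measurableTypeR R => x : R).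
transitivity (\int[nu]_(x in A) f x)%E.
  exact: (@eq_measure_integral _ _ _ _ nu).
by rewrite (ge0_integral_pushforward mid)// => x /set_mem; exact: f0.
Qed.

Section mdensity.
Local Open Scope ereal_scope.
Context d (T : measurableType d) (R : realType).
Variables (mu : {measure set T -> \bar R}) (h : T -> R).
Hypotheses (mh : measurable_fun setT h) (h0 : forall x, (0 <= h x)%R).

Definition mdensity (_ : measurable_fun setT h) (_ : forall x, (0 <= h x)%R)
  (A : set T) : \bar R := \int[mu]_(x in A) (h x)%:E.

Let mdensity0 : mdensity mh h0 set0 = 0.
Proof. by rewrite /mdensity integral_set0. Qed.

Let mdensity_ge0 A : 0 <= mdensity mh h0 A.
Proof. by apply: integral_ge0 => x _; rewrite lee_fin. Qed.

Let mdensity_sigma_additive : semi_sigma_additive (mdensity mh h0).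
Proof.
move=> F mF tF mUF; rewrite /mdensity; apply: cvg_toP.
  apply: ereal_nondecreasing_is_cvgn => m n mn.
  apply: lee_sum_nneg_natr => // k _ _.
  by apply: integral_ge0 => x _; rewrite lee_fin.
rewrite ge0_integral_bigcup//=.
- by apply/measurable_EFinP; exact: measurable_funTS.
- by move=> x _; rewrite lee_fin.
Qed.

HB.instance Definition _ := isMeasure.Build _ _ _ (mdensity mh h0)
  mdensity0 mdensity_ge0 mdensity_sigma_additive.

End mdensity.

Section tuple_density.
Local Open Scope ereal_scope.
Context d (T : measurableType d) (R : realType).
Variables (mu : {sigma_finite_measure set T -> \bar R}).

Lemma measurable_tuple_prod n (h : 'I_n -> T -> R) :
  (forall i, measurable_fun setT (h i)) ->
  measurable_fun setT (fun t : n.-tuple T => \prod_i h i (tnth t i))%R.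
Proof.
move=> mh; apply: (@measurable_prod _ (n.-tuple T) R setT 'I_n _
  (fun i t => h i (tnth t i))) => i _.
exact: (measurableT_comp (mh i) (measurable_tnth i)).
Qed.

(** Tonelli by induction: [tuple_measure] is the image of a product with the first coordinate split
    off. *)
Lemma integral_tuple_prod n (h : 'I_n -> T -> R) :
  (forall i, measurable_fun setT (h i)) -> (forall i x, (0 <= h i x)%R) ->
  \int[tuple_measure mu n]_t (\prod_i h i (tnth t i))%:E =
  \prod_i \int[mu]_x (h i x)%:E.
Proof.
elim: n h => [|n IHn] h mh h0.
  rewrite big_ord0 /=.
  under eq_integral do rewrite big_ord0.
  by rewrite integral_cst//= mul1e diracE in_setT.
have mcons := @measurable_cons_pair _ T n.
rewrite [LHS](ge0_integral_pushforward mcons)//=; last 2 first.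
- by apply/measurable_EFinP; exact: measurable_tuple_prod.
- by move=> t _; rewrite lee_fin prodr_ge0.
rewrite preimage_setT big_ord_recl -IHn//.
pose g t := (\prod_(i < n) h (lift ord0 i) (tnth t i))%R.
have mg : measurable_fun setT g.
  by apply: (@measurable_tuple_prod _ (fun i => h (lift ord0 i))).
have g0 t : (0 <= g t)%R by exact: prodr_ge0.
rewrite (eq_integral (fun z => (h ord0 z.1 * g z.2)%:E)); last first.
  move=> -[x t] _ /=; rewrite big_ord_recl; congr (_ * _)%:E.
  by apply: eq_bigr => i _; rewrite tnthS.
rewrite (@fubini_tonelli1 _ _ _ _ _ mu (tuple_measure mu n)
  (fun z => (h ord0 z.1 * g z.2)%:E))/=; last 2 first.
- apply/measurable_EFinP; apply: measurable_funM.
    exact: (measurableT_comp (mh ord0)).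
  exact: (measurableT_comp mg).
- by move=> z; rewrite lee_fin mulr_ge0.
rewrite /fubini_F /=.
under eq_integral => x _.
  under eq_integral => t _ do rewrite EFinM.
  rewrite ge0_integralZl//=; last 3 first.
  - by apply/measurable_EFinP.
  - by move=> t _; rewrite lee_fin.
  - by rewrite lee_fin.
  over.
rewrite ge0_integralZr//=.
- exact/measurable_EFinP.
- by move=> x _; rewrite lee_fin.
- by apply: integral_ge0 => t _; rewrite lee_fin.
Qed.

Lemma integral_tuple_box n (h : T -> R) (A : 'I_n -> set T) :
  measurable_fun setT h -> (forall x, (0 <= h x)%R) ->
  (forall i, measurable (A i)) ->
  \int[tuple_measure mu n]_(t in box A) (\prod_i h (tnth t i))%:E =
  \prod_i \int[mu]_(x in A i) (h x)%:E.
Proof.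
move=> mh h0 mA; rewrite integral_mkcond.
transitivity (\int[tuple_measure mu n]_t
    (\prod_i (h (tnth t i) * \1_(A i) (tnth t i)))%:E).
  apply: eq_integral => t _; rewrite patchE; case: ifPn => [/set_mem tA|].
    by congr EFin; apply: eq_bigr => i _; rewrite indicE mem_set ?mulr1//; exact: tA.
  move=> /negP tA; apply/esym/eqP; rewrite eqe prodf_seq_eq0; apply/hasP.
  have [i Ai] : exists i, ~ A i (tnth t i).
    by apply/existsNP => tA'; apply: tA; rewrite inE.
  exists i; first exact: mem_index_enum.
  by rewrite /= indicE memNset// mulr0.
rewrite (@integral_tuple_prod n (fun i x => (h x * \1_(A i) x)%R)).
- apply: eq_bigr => i _; rewrite [RHS]integral_mkcond; apply: eq_integral => x _.
  by rewrite patchE indicE; case: ifPn => _; rewrite ?mulr1 ?mulr0.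
- by move=> i; apply: measurable_funM => //; exact: measurable_indic.
- by move=> i x; rewrite mulr_ge0.
Qed.

End tuple_density.

Section integral_mpush.
Local Open Scope ereal_scope.
Context d d' (S : measurableType d) (T : measurableType d') (R : realType).
Variables (mu : {measure set S -> \bar R}) (f : S -> T) (D : set S).
Hypotheses (mf : measurable_fun setT f) (mD : measurable D).

Lemma ge0_integral_mpush (g : T -> \bar R) :
  measurable_fun setT g -> (forall y, 0 <= g y) ->
  \int[mpush mu mf mD]_y g y = \int[mu]_(x in D) g (f x).
Proof.
move=> mg g0; pose nu := mrestr mu mD.
have mgf : measurable_fun setT (g \o f) by exact: measurableT_comp.
transitivity (\int[nu]_x (g \o f) x).
  rewrite -[X in \int[nu]_(x in X) _](preimage_setT f).
  by rewrite -(ge0_integral_pushforward mf nu).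
(* The complement of [D] is null for the restricted measure, which coincides with [mu] inside
   [D]. *)
rewrite -(setvU D) ge0_integral_setU//=; last 3 first.
- exact: measurableC.
- by rewrite setvU.
- by apply/disj_setPS => x [].
rewrite [X in X + _]null_set_integral ?add0e.
- by apply: eq_measure_integral => A mA AD; exact: (congr1 mu (setIidl AD)).
- exact: measurableC.
- exact: measurable_funTS.
- exact: etrans (congr1 mu (setICl D)) (measure0 mu).
Qed.

End integral_mpush.

(** * Density of the radii *)

Section radial_density.
Variable R : realType.

(** The derivative of [2 r^n], the distribution function of the image of Lebesgue measure under
    [root_abs n]. *)
Definition root_density n (r : R) : R := 2 * n%:R * r ^+ n.-1 * \1_(`[0, +oo[%classic) r.

Lemma root_density_ge0 n r : 0 <= root_density n r.
Proof.
rewrite /root_density indicE; case: (boolP (r \in _)) => [|_]; last by rewrite mulr0.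
by rewrite inE/= in_itv/= andbT mulr1 => r0; rewrite !mulr_ge0// exprn_ge0.
Qed.

Lemma measurable_root_density n : measurable_fun setT (root_density n).
Proof.
apply: measurable_funM; last exact: measurable_indic.
by apply: measurable_funM => //; exact: measurable_funX.
Qed.

Lemma integral_root_density n (r : R) : (0 < n)%N -> 0 < r ->
  (\int[lebesgue_measure]_(x in `[0%R, r]) (2 * n%:R * x ^+ n.-1)%:E)%E =
  (2 * r ^+ n)%:E.
Proof.
move=> n0 r0; pose F (x : R) : R := 2 * x ^+ n.
have dF (x : R) : @is_derive R R R x 1 F (2 * n%:R * x ^+ n.-1).
  have dX : @is_derive R R R x 1 (fun x : R => x ^+ n) (n%:R * x ^+ n.-1).
    rewrite (_ : (fun x => _) = (id : R -> R) ^+ n); last by rewrite exprfctE.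
    rewrite -[X in is_derive _ _ _ X]mulr1; exact: (@is_deriveX R R id n x 1 1).
  rewrite -mulrA; exact: (@is_deriveZ R R R (fun x => x ^+ n) 2 x 1).
rewrite (@continuous_FTC2 R _ F)//.
- by rewrite /F expr0n gtn_eqF// mulr0 sube0.
- apply: continuous_subspaceT => x.
  apply: (@continuousM _ R (cst (2 * n%:R)) (fun x => x ^+ n.-1)); first exact: cvg_cst.
  exact: exprn_continuous.
- have cF x : F y @[y --> x] --> F x.
    by apply: differentiable_continuous; apply/derivable1_diffP; exact: ex_derive.
  split.
  + by move=> x _; exact: ex_derive.
  + exact: cvg_at_right_filter.
  + exact: cvg_at_left_filter.
- by move=> x _; rewrite derive1E; exact: derive_val.
Qed.

Lemma root_abs_density n (A : set R) : (0 < n)%N -> measurable A ->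
  lebesgue_real (root_abs n @^-1` A) =
  (\int[@lebesgue_real R]_(x in A) (root_density n x)%:E)%E.
Proof.
move=> n0 mA.
pose m1 := mpush (@lebesgue_real R) (@measurable_root_abs R n) measurableT.
have m1E B : m1 B = lebesgue_real (root_abs n @^-1` B).
  by rewrite /m1 /mpush setIT.
pose m2 := mdensity (@lebesgue_real R) (@measurable_root_density n) (@root_density_ge0 n).
rewrite -m1E -[RHS]/(m2 A).
have m2E r : m2 `]-oo, r]%classic =
    (\int[lebesgue_measure]_(x in `]-oo, r]%classic `&` `[0%R, +oo[%classic)
      (2 * n%:R * x ^+ n.-1)%:E)%E.
  rewrite /m2 /mdensity ge0_integral_lebesgue_real//; last 2 first.
  - by apply/measurable_EFinP/measurable_funTS; exact: measurable_root_density.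
  - by move=> x _; rewrite lee_fin root_density_ge0.
  rewrite integral_mkcondr; apply: eq_integral => x _; rewrite patchE /root_density indicE.
  by case: ifPn => _; rewrite ?mulr1 ?mulr0.
apply: ray_unique => // r.
  rewrite [X in (X < _)%E]m1E; have [r0|r0] := leP 0 r.
    by rewrite lebesgue_root_abs// ltry.
  by rewrite lebesgue_root_abs_lt0.
apply: (etrans (m1E _)); apply: etrans (esym (m2E _)).
(* The fundamental theorem of calculus is applied on a proper interval, so [r = 0], where the domain
   is a single point, is a separate case. *)
have [r0|r0|<-] := ltgtP 0 r.
- rewrite lebesgue_root_abs// ?ltW// -integral_root_density//; congr integral.
  by apply/seteqP; split => x /=; rewrite !in_itv/= andbT; [case/andP => -> ->|case=> -> ->].
- rewrite lebesgue_root_abs_lt0// (_ : _ `&` _ = set0) ?integral_set0//.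
  apply/seteqP; split => x //=; rewrite !in_itv/= andbT => -[xr x0].
  by have := le_lt_trans (le_trans x0 xr) r0; rewrite ltxx.
- rewrite lebesgue_root_abs// expr0n gtn_eqF// mulr0 (_ : _ `&` _ = [set 0]) ?integral_set1//.
  apply/seteqP; split => x /=; rewrite !in_itv/= andbT.
    by case=> ? ?; apply/le_anti/andP.
  by move=> ->.
Qed.

Lemma root_map_density n m (A : set (m.-tuple R)) : (0 < n)%N -> measurable A ->
  lebesgue_tuple R m (@root_map R n m @^-1` A) =
  (\int[lebesgue_tuple R m]_(t in A) (\prod_i root_density n (tnth t i))%:E)%E.
Proof.
move=> n0 mA.
have mh : measurable_fun setT
    (fun t : m.-tuple R => \prod_i root_density n (tnth t i)).
  by apply: (@measurable_tuple_prod _ R R m (fun=> root_density n)) => i;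
    exact: measurable_root_density.
have h0 (t : m.-tuple R) : 0 <= \prod_i root_density n (tnth t i).
  by apply: prodr_ge0 => i _; exact: root_density_ge0.
pose m1 := mpush (lebesgue_tuple R m) (@measurable_root_map R m n) measurableT.
have m1E B : m1 B = lebesgue_tuple R m (@root_map R n m @^-1` B).
  by rewrite /m1 /mpush setIT.
pose m2 := mdensity (lebesgue_tuple R m) mh h0.
rewrite -m1E -[RHS]/(m2 A).
have m1box C : (forall i, measurable (C i)) ->
    m1 (box C) = (\prod_i lebesgue_real (root_abs n @^-1` C i))%E.
  move=> mC; rewrite m1E -lebesgue_tuple_box; last first.
    by move=> i; rewrite -[X in measurable X]setTI; exact: measurable_root_abs.
  congr (lebesgue_tuple R m _).
  by apply/seteqP; split => x /= H i; have := H i; rewrite tnth_mktuple.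
apply: (@tuple_measure_unique _ R R m (fun k => `]-oo, k%:R]%classic) m1 m2) => //.
- move=> k l kl; apply/subsetPset => x /=; rewrite !in_itv/= => xk.
  by rewrite (le_trans xk)// ler_nat.
- apply/seteqP; split=> // x _; exists (Num.truncn `|x|).+1 => //=.
  by rewrite in_itv/= (le_trans (ler_norm x))// ltW// truncnS_gt.
- move=> k; rewrite [X in (X < _)%E](m1box (fun=> `]-oo, k%:R]%classic))//.
  rewrite (eq_bigr (fun=> (2 * k%:R ^+ n)%:E)); last first.
    by move=> i _; rewrite lebesgue_root_abs.
  by rewrite prodEFin ltry.
- move=> C mC; apply: (etrans (m1box _ mC)).
  rewrite -[RHS]/(mdensity (lebesgue_tuple R m) mh h0 (box C)) /mdensity.
  rewrite integral_tuple_box//; last 2 first.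
  + exact: measurable_root_density.
  + exact: root_density_ge0.
  by apply: eq_bigr => i _; rewrite root_abs_density.
Qed.

End radial_density.

(** * Product densities that depend only on the norm *)

Section norm_density.
Variables (R : realType) (q : \bar R) (n : nat).
Hypotheses (q0 : (0 < q)%E) (n0 : (0 < n)%N).
Variables (gamma : probability R R) (h G : R -> R).
Hypotheses (mh : measurable_fun setT h) (h0 : forall x, 0 <= h x).
Hypothesis gammaE : forall A, measurable A ->
  gamma A = (\int[@lebesgue_real R]_(x in A) (h x)%:E)%E.
Hypotheses (mG : measurable_fun setT G) (G0 : forall r, 0 <= G r).
Hypothesis hG : forall t : n.-tuple R,
  \prod_i h (tnth t i) = G (lpnorm q t).

Lemma tuple_measure_density (A : set (n.-tuple R)) : measurable A ->
  tuple_measure gamma n A =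
  (\int[lebesgue_tuple R n]_(t in A) (G (lpnorm q t))%:E)%E.
Proof.
move=> mA.
have mGN : measurable_fun setT (fun t : n.-tuple R => G (lpnorm q t)).
  exact: (measurableT_comp mG (@measurable_lpnorm R q n)).
pose m2 := mdensity (lebesgue_tuple R n) mGN (fun t => G0 _).
rewrite -[RHS]/(m2 A).
apply: (@pi_generator_unique _ _ R (boxes n measurable) (tuple_measure gamma n) m2) => //.
- exact/pi_generator_boxes/pi_generator_measurable.
- rewrite -(@boxT R n) [X in (X < _)%E]tuple_measure_box//.
  by rewrite big1 ?ltry// => i _; exact: probability_setT.
- move=> _ [B mB <-]; rewrite [LHS]tuple_measure_box//.
  rewrite (eq_bigr (fun i => \int[@lebesgue_real R]_(x in B i) (h x)%:E)%E).
    rewrite -integral_tuple_box//.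
    by apply: eq_integral => t _; rewrite hG.
  by move=> i _; exact: gammaE (mB i).
Qed.

(** By the polar decomposition, the direction lies in [B] with probability proportional to the
    volume of the sector over [B]. The factor, built from [K], is the same for all [B], so it is
    known from [B = setT]. *)
Lemma tuple_measure_normalize (B : set (n.-tuple R)) : measurable B ->
  tuple_measure gamma n (@normalize R q n @^-1` B) = angular_prob q B.
Proof.
pose K := (\int[mpush (@lebesgue_real R) (@measurable_root_abs R n) measurableT]_r (G r)%:E)%E.
have mGE : measurable_fun setT (EFin \o G) by exact/measurable_EFinP.
have K0 : (0 <= K)%E by apply: integral_ge0 => r _; rewrite lee_fin.
have lawE C : measurable C ->
    tuple_measure gamma n (@normalize R q n @^-1` C) =
    (2^-1%:E * lebesgue_tuple R n (sector q C) * K)%E.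
  move=> mC; have mNC := measurable_preimage_normalize q mC.
  rewrite tuple_measure_density//.
  (* The integral over the points with direction in [C] becomes the integral of [G] against the
     image under the norm of Lebesgue measure restricted to these points, which is a multiple of the
     measure defining [K]. *)
  rewrite -(@ge0_integral_mpush _ _ _ _ _ _ _ _ (@measurable_lpnorm R q n) mNC (EFin \o G))//.
  have sCfin : lebesgue_tuple R n (sector q C) \is a fin_num.
    by rewrite ge0_fin_numE// sector_lty.
  have c0 : 0 <= 2^-1 * fine (lebesgue_tuple R n (sector q C)).
    by rewrite mulr_ge0// fine_ge0.
  rewrite -[X in (_ = _ * X * _)%E]fineK// -EFinM.
  rewrite -(@ge0_integral_mscale _ _ _ _ _ _ (NngNum c0))//=.
    apply: eq_measure_integral => A mA _.
    apply: etrans (polar_decomposition q0 n0 mA mC) _.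
    rewrite -[X in (_ * X * _ = _)%E]fineK// -EFinM.
    by rewrite -[X in lebesgue_real X]setIT.
  by move=> r _; rewrite lee_fin.
have tot : (2^-1%:E * lpball_volume q n * K = 1)%E.
  have -> : lpball_volume q n = lebesgue_tuple R n (sector q setT).
    by rewrite /sector preimage_setT setIT.
  rewrite -lawE// preimage_setT -(@boxT R n) [LHS]tuple_measure_box//.
  by rewrite big1// => i _; exact: probability_setT.
move=> mB; rewrite lawE// sector_volume//.
by rewrite muleA -[LHS]muleA [X in (_ * X)%E]muleC muleA tot mul1e.
Qed.

End norm_density.

(** * [p]-Gaussian distributions *)

Section gamma_integral.
Variable R : realType.
Implicit Types a r : R.

(** Euler's integral for Gamma at [a + 1], kept as an extended real until its finiteness is
    known. *)
Definition gamma_integral a : \bar R :=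
  (\int[@lebesgue_real R]_(t in `]0%R, +oo[) (t `^ a * expR (- t))%:E)%E.

Let measurable_gamma_integrand a :
  measurable_fun setT (fun t : R => t `^ a * expR (- t)).
Proof.
apply: measurable_funM; first exact: measurable_powR.
by apply: (measurableT_comp (@measurable_expR R)); exact: measurable_funN.
Qed.

Let gamma_integrand_ge0 a t : 0 <= t `^ a * expR (- t).
Proof. by rewrite mulr_ge0 ?powR_ge0 ?expR_ge0. Qed.

Lemma gamma_integral_ge0 a : (0 <= gamma_integral a)%E.
Proof. by apply: integral_ge0 => t _; rewrite lee_fin. Qed.

Lemma GammaE s : Gamma s = fine (gamma_integral (s - 1)).
Proof.
rewrite /Gamma /Rintegral /gamma_integral ge0_integral_lebesgue_real//.
- by apply/measurable_EFinP/measurable_funTS.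
- by move=> t _; rewrite lee_fin.
Qed.

(** Half of the exponential decay absorbs the power. The other half is twice the exponential density
    of rate 1/2, which has mass one. *)
Lemma gamma_integral_lty a : 0 < a -> (gamma_integral a < +oo)%E.
Proof.
move=> a0; pose c : R := (2 * a) `^ a.
have c0 : 0 <= c by exact: powR_ge0.
have half0 : 0 < 2^-1 :> R by rewrite invr_gt0.
have le t : 0 < t -> t `^ a * expR (- t) <= c * 2 * exponential_pdf 2^-1 t.
  move=> t0; rewrite exponential_pdfE ?(ltW t0)// -mulrA mulVKf//.
  (* [t <= 2a exp(t/(2a))], hence [t^a <= (2a)^a exp(t/2)] *)
  have -> : expR (- 2^-1 * t) = expR (t / 2) * expR (- t).
    by rewrite -expRD; congr expR; field.
  rewrite mulrA ler_wpM2r ?expR_ge0//.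
  have a20 : 0 < 2 * a by rewrite mulr_gt0.
  have -> : expR (t / 2) = expR (t / (2 * a)) `^ a.
    by rewrite -expRM; congr expR; field; exact: lt0r_neq0.
  rewrite -powRM ?expR_ge0 ?(ltW a20)//; apply: ge0_ler_powR.
  - exact: ltW.
  - by rewrite nnegrE ltW.
  - by rewrite nnegrE mulr_ge0 ?expR_ge0// ltW.
  - rewrite -ler_pdivrMl// mulrC.
    by rewrite (le_trans _ (expR_ge1Dx _))// lerDr.
have mpdf : measurable_fun setT (exponential_pdf (2^-1 : R)).
  exact: measurable_exponential_pdf.
have pdf0 t : 0 <= exponential_pdf (2^-1 : R) t.
  by apply: exponential_pdf_ge0; exact: ltW.
apply: (@le_lt_trans _ _
    (\int[@lebesgue_real R]_t (c * 2 * exponential_pdf 2^-1 t)%:E)%E).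
  apply: (@le_trans _ _ (\int[@lebesgue_real R]_(t in `]0%R, +oo[)
      (c * 2 * exponential_pdf 2^-1 t)%:E)%E).
    apply: ge0_le_integral => //.
    - by move=> t _; rewrite lee_fin.
    - by apply/measurable_EFinP/measurable_funTS.
    - by apply/measurable_EFinP/measurable_funTS; exact: measurable_funM.
    - by move=> t; rewrite /= in_itv/= andbT => t0; rewrite lee_fin le.
  apply: ge0_subset_integral => //.
  - by apply/measurable_EFinP; exact: measurable_funM.
  - by move=> t _; rewrite lee_fin !mulr_ge0.
under eq_integral do rewrite EFinM.
rewrite ge0_integralZl//; last 3 first.
- exact/measurable_EFinP.
- by move=> t _; rewrite lee_fin.
- by rewrite lee_fin mulr_ge0.
rewrite ge0_integral_lebesgue_real//.
- by rewrite integral_exponential_pdf// mule1 ltry.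
- exact/measurable_EFinP.
- by move=> t _; rewrite lee_fin.
Qed.

Lemma integral_expRN_tail a :
  (\int[@lebesgue_real R]_(u in `[a, +oo[) (expR (- u))%:E)%E = (expR (- a))%:E.
Proof.
have cexp : continuous (fun x : R => expR (- x)).
  by move=> x; apply: continuous_comp; [exact: opp_continuous|exact: continuous_expR].
rewrite ge0_integral_lebesgue_real//; last first.
  by apply/measurable_EFinP/measurable_funTS; exact: continuous_measurable_fun.
rewrite (@ge0_continuous_FTC2y R _ (fun x => - expR (- x)) _ 0)//.
- by rewrite sub0e EFinN oppeK.
- exact: continuous_subspaceT.
- by rewrite -oppr0; apply: cvgN; exact: cvgr_expR.
- by apply: cvgN; apply: cvg_at_right_filter; exact: cexp.
- move=> x _; rewrite derive1_comp// derive1N// derive1_id mulN1r.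
  rewrite derive1_comp// derive1E; have /funeqP -> := @derive_expR R.
  by rewrite derive1N// derive1_id mulrN1 opprK.
Qed.

(* Layer cake: [e^{-|x|^r/r}] is the integral of [e^{-u}] over [u >= |x|^r/r];
   exchanging the integrals reduces the claim to the length of
   [{x | |x|^r <= r u}], with no change of variables. *)
Lemma integral_expR_powR r : 0 < r ->
  (\int[@lebesgue_real R]_x (expR (- (`|x| `^ r / r)))%:E =
   (2 * r `^ r^-1)%:E * gamma_integral r^-1)%E.
Proof.
move=> r0; pose D : set (R * R) := [set z | `|z.1| `^ r / r <= z.2].
have mD : measurable D.
  rewrite (_ : D = (fun z : R * R => `|z.1| `^ r / r - z.2) @^-1` `]-oo, 0]%classic).
    rewrite -[X in measurable X]setTI; apply: measurable_funB => //.
    apply: measurable_funM => //; apply: (measurableT_comp (measurable_powR _)).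
    exact: measurableT_comp.
  by apply/seteqP; split => z /=; rewrite in_itv/= subr_le0.
pose f (z : R * R) : \bar R := (\1_D z * expR (- z.2))%:E.
have mf : measurable_fun setT f.
  apply/measurable_EFinP; apply: measurable_funM; first exact: measurable_indic.
  by apply: (measurableT_comp (@measurable_expR R)); exact: measurable_funN.
have f0 z : (0 <= f z)%E by rewrite lee_fin mulr_ge0 ?expR_ge0.
transitivity (\int[@lebesgue_real R]_x \int[@lebesgue_real R]_u f (x, u))%E.
  apply: eq_integral => x _; rewrite -integral_expRN_tail integral_mkcond.
  apply: eq_integral => u _; rewrite patchE /f indicE /D/=.
  have -> : (u \in `[`|x| `^ r / r, +oo[%classic) = (`|x| `^ r / r <= u).
    by apply/idP/idP; rewrite inE /= in_itv/= andbT.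
  case: ifPn => xu; first by rewrite mem_set// mul1r.
  by rewrite memNset ?mul0r//=; exact/negP.
rewrite fubini_tonelli//.
have inner u : (\int[@lebesgue_real R]_x f (x, u) =
    (2 * r `^ r^-1)%:E *
    ((fun t => (t `^ r^-1 * expR (- t))%:E) \_ `]0%R, +oo[) u)%E.
  rewrite patchE.
  have uE x : 0 < u -> (`|x| `^ r / r <= u) = (x \in `[- (r * u) `^ r^-1, (r * u) `^ r^-1]).
    move=> u0; rewrite in_itv/= -ler_norml ler_pdivrMr// [u * r]mulrC.
    have ru0 : 0 <= r * u by rewrite mulr_ge0// ltW.
    have ruE : r * u = ((r * u) `^ r^-1) `^ r.
      by rewrite -powRrM mulVf ?gt_eqF// powRr1.
    rewrite {1}ruE.
    apply/idP/idP => h; last first.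
      by apply: ge0_ler_powR; rewrite ?nnegrE ?powR_ge0// ltW.
    rewrite leNgt; apply/negP => h'; move: h; apply/negP; rewrite -ltNge.
    by apply: gt0_ltr_powR; rewrite ?nnegrE ?powR_ge0.
  rewrite mem_setE in_itv/= andbT; case: ifPn.
    move=> u0; transitivity (\int[@lebesgue_real R]_(x in
        `[(- (r * u) `^ r^-1)%R, ((r * u) `^ r^-1)%R])
        (cst (expR (- u))%:E x))%E.
      rewrite [RHS]integral_mkcond; apply: eq_integral => x _.
      rewrite patchE mem_setE -uE// /f indicE /D/=.
      case: ifPn => xu; first by rewrite mem_set// mul1r.
      by rewrite memNset ?mul0r//=; exact/negP.
    transitivity ((expR (- u))%:E * @lebesgue_real R
        `[(- (r * u) `^ r^-1)%R, ((r * u) `^ r^-1)%R])%E.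
      exact: integral_cst.
    rewrite lebesgue_real_itv ?ge0_cp ?powR_ge0//.
    rewrite -!EFinM; congr EFin; rewrite powRM ?(ltW r0) ?(ltW u0)//=; ring.
  (* For [u <= 0] the section of [D] lies in [{0}], a null set. At [u = 0] it does contain the
     origin. *)
  move=> u0; rewrite mule0.
  have {}u0 : u <= 0 by rewrite leNgt.
  transitivity (\int[@lebesgue_real R]_(x in [set 0%R]) (f (x, u)))%E; last first.
    rewrite ge0_integral_lebesgue_real//; first exact: integral_set1.
    apply: measurable_funTS; apply: (measurableT_comp mf).
    exact: measurable_fun_pair.
  rewrite [RHS]integral_mkcond; apply: eq_integral => x _.
  rewrite patchE; case: ifPn => //; rewrite notin_setE /= => x0.
  rewrite /f indicE memNset ?mul0r// /D/=; apply/negP; rewrite -ltNge.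
  apply: (le_lt_trans u0); rewrite divr_gt0// powR_gt0// normr_gt0.
  exact/eqP.
under eq_integral do rewrite inner.
rewrite ge0_integralZl//.
- by rewrite /gamma_integral [in RHS]integral_mkcond.
- apply/(measurable_restrictT _ _).1 => //.
  by apply/measurable_EFinP/measurable_funTS.
- by move=> u _; apply: erestrict_ge0 => t _; rewrite lee_fin.
- by rewrite lee_fin mulr_ge0 ?powR_ge0.
Qed.

(** If it vanished, [integral_expR_powR] would make the Gaussian integral vanish, although its
    integrand is at least [expR (- r^-1)] on [[0, 1]]. *)
Lemma gamma_integral_gt0 r : 0 < r -> (0 < gamma_integral r^-1)%E.
Proof.
move=> r0; rewrite lt_neqAle gamma_integral_ge0 andbT; apply/negP => /eqP g0.
have := integral_expR_powR r0; rewrite -g0 mule0 => int0.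
have mexp : measurable_fun setT (fun x : R => expR (- (`|x| `^ r / r))).
  apply: (measurableT_comp (@measurable_expR R)); apply: measurable_funN.
  by apply: measurable_funM => //; apply: (measurableT_comp (measurable_powR _)).
have : ((expR (- r^-1))%:E <= 0 :> \bar R)%E.
  rewrite -int0; apply: (@le_trans _ _ (\int[@lebesgue_real R]_(x in `[0%R, 1%R])
     (expR (- (`|x| `^ r / r)))%:E)%E); last first.
    by apply: ge0_subset_integral => //; exact/measurable_EFinP.
  apply: (@le_trans _ _ (\int[@lebesgue_real R]_(x in `[0%R, 1%R])
     (cst (expR (- r^-1))%:E x))%E).
    rewrite le_eqVlt; apply/orP; left; apply/eqP.
    transitivity ((expR (- r^-1))%:E * @lebesgue_real R `[0%R, 1%R])%E.
      by rewrite lebesgue_real_itv// subr0 mule1.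
    exact/esym/integral_cst.
  apply: ge0_le_integral => //.
  - by move=> x _; rewrite lee_fin expR_ge0.
  - by apply/measurable_EFinP/measurable_funTS.
  - move=> x; rewrite /= in_itv/= => /andP[x0 x1].
    rewrite lee_fin ler_expR lerN2 -[leRHS]mul1r ler_wpM2r ?invr_ge0 ?(ltW r0)//.
    rewrite ger0_norm//; apply: (@le_trans _ _ (1 `^ r)); last by rewrite powR1.
    by apply: ge0_ler_powR; rewrite ?nnegrE// ltW.
by rewrite lee_fin leNgt expR_gt0.
Qed.

End gamma_integral.

Section p_gaussian.
Variable R : realType.
Implicit Types q : \bar R.

Lemma measurable_exp_norm_powR (r : R) :
  measurable_fun setT (fun x : R => expR (- (`|x| `^ r / r))).
Proof.
apply: (measurableT_comp (@measurable_expR R)); apply: measurable_funN.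
by apply: measurable_funM => //; apply: (measurableT_comp (measurable_powR _)).
Qed.

Lemma measurable_pgaussian_pdf q : measurable_fun setT (pgaussian_pdf q).
Proof.
case: q => [r||] /=; last 2 first.
- by apply: measurable_funM => //; exact: measurable_indic.
- by apply: measurable_funM => //; exact: measurable_indic.
by apply: measurable_funM => //; exact: measurable_exp_norm_powR.
Qed.

Lemma Gamma_inv (r : R) : Gamma (r^-1 + 1) = fine (gamma_integral r^-1).
Proof. by rewrite GammaE addrK. Qed.

Lemma Gamma_ge0 (s : R) : 0 <= Gamma s.
Proof. by rewrite GammaE fine_ge0// gamma_integral_ge0. Qed.

Lemma pgaussian_pdf_ge0 q x : (0 < q)%E -> 0 <= pgaussian_pdf q x.
Proof.
case: q => [r||] //= _.
by rewrite mulr_ge0 ?expR_ge0// invr_ge0 !mulr_ge0 ?powR_ge0 ?Gamma_ge0.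
Qed.

Lemma integral_pgaussian_pdf q : (0 < q)%E ->
  (\int[@lebesgue_real R]_x (pgaussian_pdf q x)%:E = 1)%E.
Proof.
case: q => [r||] //= q0; last first.
  under eq_integral do rewrite EFinM.
  rewrite ge0_integralZl//; last first.
    by apply/measurable_EFinP; exact: measurable_indic.
  rewrite integral_indic// setIT.
  transitivity (2^-1%:E * @lebesgue_real R `[(- 1)%R, 1%R])%E => //.
  by rewrite lebesgue_real_itv ?ge0_cp// -EFinM opprK mulVf.
rewrite lte_fin in q0.
under eq_integral do rewrite EFinM.
have g0 := gamma_integral_gt0 q0.
have gy : (gamma_integral r^-1 < +oo)%E by apply: gamma_integral_lty; rewrite invr_gt0.
have gfin : gamma_integral r^-1 \is a fin_num by rewrite ge0_fin_numE// ltW.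
have fg0 : 0 < fine (gamma_integral r^-1) by rewrite fine_gt0// g0.
have c0 : 0 < 2 * r `^ r^-1 * Gamma (r^-1 + 1).
  by rewrite Gamma_inv !mulr_gt0// powR_gt0.
rewrite ge0_integralZl//; last 2 first.
- by apply/measurable_EFinP; exact: measurable_exp_norm_powR.
- by rewrite lee_fin invr_ge0 ltW.
rewrite integral_expR_powR// -[gamma_integral _]fineK// -Gamma_inv -!EFinM.
by rewrite mulVf// gt_eqF.
Qed.

(** The positivity proof is an argument because the probability structure depends on it. *)
Definition gaussian_prob q of (0 < q)%E : set R -> \bar R :=
  fun A => (\int[@lebesgue_real R]_(x in A) (pgaussian_pdf q x)%:E)%E.

Section gaussian_prob.
Variables (q : \bar R) (q0 : (0 < q)%E).

Let gaussian_density :=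
  mdensity (@lebesgue_real R) (measurable_pgaussian_pdf q)
    (fun x => pgaussian_pdf_ge0 x q0).

Let gaussian_prob0 : gaussian_prob q0 set0 = 0%E.
Proof. exact: (measure0 gaussian_density). Qed.

Let gaussian_prob_ge0 A : (0 <= gaussian_prob q0 A)%E.
Proof. exact: (measure_ge0 gaussian_density). Qed.

Let gaussian_prob_sigma_additive : semi_sigma_additive (gaussian_prob q0).
Proof. exact: (@measure_semi_sigma_additive _ _ _ gaussian_density). Qed.

HB.instance Definition _ := isMeasure.Build _ _ _ (gaussian_prob q0)
  gaussian_prob0 gaussian_prob_ge0 gaussian_prob_sigma_additive.

Let gaussian_prob_setT : gaussian_prob q0 [set: R] = 1%E.
Proof. exact: integral_pgaussian_pdf. Qed.

HB.instance Definition _ := @Measure_isProbability.Build _ _ R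
  (gaussian_prob q0) gaussian_prob_setT.

End gaussian_prob.

(** The density of [n] independent [q]-Gaussian variables as a function of the norm [s]. For
    [q = +oo] all coordinates lie in [[-1, 1]] exactly when [s <= 1]. *)
Definition norm_pdf q n (s : R) : R :=
  match q with
  | r%:E => (2 * r `^ r^-1 * Gamma (r^-1 + 1))^-1 ^+ n * expR (- (`|s| `^ r / r))
  | _ => 2^-1 ^+ n * \1_(`]-oo, 1]%classic) s
  end.

Lemma measurable_norm_pdf q n : measurable_fun setT (norm_pdf q n).
Proof.
case: q => [r||] /=; last 2 first.
- by apply: measurable_funM => //; exact: measurable_indic.
- by apply: measurable_funM => //; exact: measurable_indic.
by apply: measurable_funM => //; exact: measurable_exp_norm_powR.
Qed.

Lemma norm_pdf_ge0 q n s : (0 < q)%E -> 0 <= norm_pdf q n s.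
Proof.
case: q => [r||] //= _.
rewrite mulr_ge0 ?expR_ge0// exprn_ge0// invr_ge0.
by rewrite !mulr_ge0 ?powR_ge0 ?Gamma_ge0.
Qed.

Lemma prod_pgaussian_pdf q n (t : n.-tuple R) : (0 < q)%E ->
  \prod_i pgaussian_pdf q (tnth t i) = norm_pdf q n (lpnorm q t).
Proof.
case: q => [r||] //= q0; rewrite big_split/= prodr_const card_ord; congr (_ * _).
  rewrite lte_fin in q0.
  have s0 : 0 <= \sum_(i < n) `|tnth t i| `^ r.
    by apply: sumr_ge0 => i _; exact: powR_ge0.
  rewrite ger0_norm ?powR_ge0// -powRrM mulVf ?gt_eqF// powRr1//.
  rewrite mulr_suml -sumrN expR_sum//.
rewrite indicE mem_setE in_itv/=.
have [t1|t1] := leP (\big[Num.max/0]_(i < n) `|tnth t i|) 1.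
  rewrite big1// => i _; rewrite indicE mem_set//= in_itv/= -ler_norml.
  exact: le_trans (le_bigmax _ (fun i => `|tnth t i|) i) t1.
have [i it1] : exists i, 1 < `|tnth t i|.
  apply/not_existsP => h; move: t1; apply/negP; rewrite -leNgt.
  by apply: bigmax_le => // i _; rewrite leNgt; apply/negP/h.
rewrite (bigD1 i)//= indicE memNset ?mul0r//= in_itv/= -ler_norml.
by apply/negP; rewrite -ltNge.
Qed.

Lemma tuple_gaussian_normalize q n (q0 : (0 < q)%E) (B : set (n.-tuple R)) :
  (0 < n)%N -> measurable B ->
  tuple_measure (gaussian_prob q0) n (@normalize R q n @^-1` B) = angular_prob q B.
Proof.
move=> n0; apply: (@tuple_measure_normalize R q n q0 n0 (gaussian_prob q0)
  (pgaussian_pdf q) (norm_pdf q n)).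
- exact: measurable_pgaussian_pdf.
- by move=> x; exact: pgaussian_pdf_ge0.
- by [].
- exact: measurable_norm_pdf.
- by move=> r; exact: norm_pdf_ge0.
- by move=> t; exact: prod_pgaussian_pdf.
Qed.

(** This serves the case [p = +oo], where [p/n] is [+oo] too: the vector is already uniform on the
    cube. *)
Lemma tuple_gaussian_y n (q0 : (0 < +oo :> \bar R)%E) (A : set (n.-tuple R)) :
  (0 < n)%N -> measurable A ->
  tuple_measure (gaussian_prob q0) n A =
  (lebesgue_tuple R n (A `&` lpball +oo n) / lpball_volume +oo n)%E.
Proof.
move=> n0 mA.
have law C : measurable C -> tuple_measure (gaussian_prob q0) n C =
    ((2^-1 ^+ n)%:E * lebesgue_tuple R n (C `&` lpball +oo n))%E.
  move=> mC; rewrite (@tuple_measure_density R +oo n (gaussian_prob q0)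
    (pgaussian_pdf +oo) (norm_pdf +oo n))//; first last.
  - by move=> t; exact: prod_pgaussian_pdf.
  - by move=> r; exact: norm_pdf_ge0.
  - exact: measurable_norm_pdf.
  - by move=> x; exact: pgaussian_pdf_ge0.
  - exact: measurable_pgaussian_pdf.
  have mb : measurable (lpball +oo n : set (n.-tuple R)) by exact: measurable_lpball.
  have c0 : (0 <= (2^-1 ^+ n)%:E :> \bar R)%E by rewrite lee_fin exprn_ge0.
  transitivity (\int[lebesgue_tuple R n]_(t in C)
      ((2^-1 ^+ n)%:E * (\1_(lpball +oo n) t)%:E))%E.
    by apply: eq_integral => t _; rewrite -EFinM.
  rewrite ge0_integralZl//.
  - by rewrite integral_indic// setIC.
  - by apply/measurable_EFinP/measurable_funTS; exact: measurable_indic.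
have tot : ((2^-1 ^+ n)%:E * lpball_volume +oo n = 1 :> \bar R)%E.
  rewrite /lpball_volume -[X in lebesgue_tuple R n X]setTI -law//.
  rewrite -(@boxT R n) [LHS]tuple_measure_box//.
  by rewrite big1// => i _; exact: (@probability_setT _ _ _ (gaussian_prob q0)).
have Vfin := @lpball_volume_fin_num R _ n q0.
rewrite law//.
rewrite -[X in (X * _ = _)%E]mule1 -(@divee _ (@lpball_volume R +oo n))//.
  by rewrite muleA tot mul1e muleC.
by rewrite gt_eqF// lpball_volume_gt0.
Qed.

End p_gaussian.

(** * Radial representation *)

Section uniform_real.
Variable R : realType.

(** The same function as [uniform_prob], placed on the Borel structure of [R] like
    [lebesgue_real]. *)
Definition unif_real : set R -> \bar R := uniform_prob (@ltr01 R).

HB.instance Definition _ := isMeasure.Build _ R R unif_real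
  (measure0 (uniform_prob (@ltr01 R))) (measure_ge0 (uniform_prob (@ltr01 R)))
  (@measure_semi_sigma_additive _ _ _ (uniform_prob (@ltr01 R))).

HB.instance Definition _ := @Measure_isProbability.Build _ R R unif_real
  (probability_setT (uniform_prob (@ltr01 R))).

Lemma unif_realE A : measurable A -> unif_real A = lebesgue_real (A `&` `[0, 1]%classic).
Proof.
move=> mA; rewrite /unif_real /uniform_prob integral_uniform_pdf.
rewrite (eq_integral (cst 1%E)); last first.
  move=> x; rewrite inE/= => -[_]; rewrite in_itv/= /uniform_pdf => ->.
  by rewrite subr0 invr1.
rewrite integral_cst ?mul1e//; exact: measurableI.
Qed.

(** Both sides have distribution function [r^m] on [[0, 1]]. This is the law of the norm of a
    uniform point of a unit ball in dimension [m], hence the exponent [1/m]. *)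
Lemma unif_real_powR m (A : set R) : (0 < m)%N -> measurable A ->
  unif_real ((@powR R ^~ m%:R^-1) @^-1` A) =
  (2^-1%:E * lebesgue_real (root_abs m @^-1` (A `&` `]-oo, 1%R]%classic)))%E.
Proof.
move=> m0 mA; have half0 : 0 <= 2^-1 :> R by rewrite invr_ge0.
have m1' : measurable (root_abs m @^-1` `]-oo, (1 : R)]%classic).
  by rewrite -[X in measurable X]setTI; exact: measurable_root_abs.
pose m1 := mpush unif_real (@measurable_powR R m%:R^-1) measurableT.
pose m2 := mscale (NngNum half0) (mpush (@lebesgue_real R) (@measurable_root_abs R m) m1').
have m1E B : m1 B = unif_real ((@powR R ^~ m%:R^-1) @^-1` B).
  by rewrite /m1 /mpush setIT.
have m2E B : m2 B =
  (2^-1%:E * lebesgue_real (root_abs m @^-1` (B `&` `]-oo, 1%R]%classic)))%E by [].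
rewrite -m1E -m2E; apply: ray_unique => // r.
  apply: (@le_lt_trans _ _ 1%E); last exact: ltry.
  rewrite [X in (X <= _)%E]m1E; apply: probability_le1.
  by rewrite -[X in measurable X]setTI; exact: measurable_powR.
apply: etrans (m1E _) (etrans _ (esym (m2E _))).
have mp : measurable ((@powR R ^~ m%:R^-1) @^-1` `]-oo, r]%classic).
  by rewrite -[X in measurable X]setTI; exact: measurable_powR.
rewrite unif_realE//.
have itvE s : `]-oo, s]%classic `&` `]-oo, 1]%classic = `]-oo, Num.min s 1]%classic :> set R.
  by apply/seteqP; split => z /=; rewrite !in_itv/= le_min;
    [case=> -> -> | move/andP].
rewrite itvE.
have [r0|r0] := leP 0 r; last first.
  rewrite lebesgue_root_abs_lt0 ?mule0; last by rewrite gt_min r0.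
  rewrite (_ : _ `&` _ = set0) ?measure0//.
  apply/seteqP; split=> x //=; rewrite in_itv/= => -[xr _].
  by have := le_lt_trans xr r0; rewrite ltNge powR_ge0.
have min0 : 0 <= Num.min r 1 by rewrite le_min r0/=.
rewrite lebesgue_root_abs// -EFinM mulKf//.
transitivity (@lebesgue_real R `[0, Num.min r 1 ^+ m]%classic); last first.
  by rewrite lebesgue_real_itv ?exprn_ge0// subr0.
congr lebesgue_real; apply/seteqP; split => x /=; rewrite !in_itv/=.
  case=> xr /andP[x0 x1]; rewrite x0/= -[leLHS]ger0_norm// -root_abs_le//.
  by rewrite le_min (@root_abs_le R m x 1)// expr1n /root_abs !ger0_norm// xr x1.
case/andP => x0; rewrite -[leLHS]ger0_norm// -root_abs_le// le_min.
by rewrite (@root_abs_le R m x 1)// expr1n /root_abs !ger0_norm// x0 => /andP[-> ->].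
Qed.

End uniform_real.

Section tuple_probability.
Context d (T : measurableType d) (R : realType).
Variables (gamma : probability T R) (n : nat).

(* [tuple_measure gamma n] is a projection of a record: a constant is needed as
   the key of the probability structure. *)
Definition tuple_prob : set (n.-tuple T) -> \bar R := tuple_measure gamma n.

HB.instance Definition _ := Measure.on tuple_prob.

Let tuple_prob_setT : tuple_prob [set: n.-tuple T] = 1%E.
Proof.
rewrite -(@boxT T n) /tuple_prob [LHS]tuple_measure_box//.
by rewrite big1// => i _; exact: probability_setT.
Qed.

HB.instance Definition _ := @Measure_isProbability.Build _ _ R
  tuple_prob tuple_prob_setT.

End tuple_probability.
Arguments tuple_prob {d T R} gamma n.

Section radial_law.
Variable R : realType.
Implicit Types p q : \bar R.

Lemma powR_le1 (s a : R) : 0 <= s -> 0 < a -> (s `^ a <= 1) = (s <= 1).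
Proof.
move=> s0 a0; apply/idP/idP => h.
  rewrite leNgt; apply/negP => s1; move: h; apply/negP; rewrite -ltNge.
  rewrite -[ltLHS]/(1 : R) -(_ : 1 `^ a = 1); last by rewrite powR1.
  by apply: gt0_ltr_powR; rewrite ?nnegrE.
rewrite -(_ : 1 `^ a = 1); last by rewrite powR1.
by apply: ge0_ler_powR; rewrite ?nnegrE// ltW.
Qed.

Lemma exponent_divE (r : R) n : (0 < n)%N ->
  (r%:E / n%:R%:E = (r / n%:R)%:E :> \bar R)%E.
Proof. by move=> n0; rewrite inver ifF// pnatr_eq0 gtn_eqF. Qed.

Lemma exponent_div_gt0 p n : (0 < p)%E -> (0 < n)%N -> (0 < p / n%:R%:E)%E.
Proof.
case: p => [r||]//= r0 n0; last first.
  by rewrite gt0_mulye// inve_gt0// ?eqe ?pnatr_eq0 ?gtn_eqF// lte_fin ltr0n.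
by rewrite exponent_divE// lte_fin divr_gt0// ltr0n.
Qed.

Lemma exponent_divy n : (0 < n)%N -> (+oo / n%:R%:E = +oo :> \bar R)%E.
Proof.
by move=> n0; rewrite inver ifF ?pnatr_eq0 ?gtn_eqF// gt0_mulye// lte_fin invr_gt0 ltr0n.
Qed.

(** The origin of [p/n]: the [p]-th power of [|t|^(1/n)] is [|t|^(p/n)]. The outer exponents [1/p]
    and [n/p] differ, but both preserve comparison with 1. *)
Lemma preimage_root_map_lpball p n m : (0 < p)%E -> (0 < n)%N ->
  @root_map R n m @^-1` lpball p m = lpball (p / n%:R%:E)%E m.
Proof.
move=> p0 n0; have n0' : 0 < n%:R :> R by rewrite ltr0n.
apply/seteqP; suff H t : lpball p m (@root_map R n m t) <-> lpball (p / n%:R%:E)%E m t.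
  by split => t /H.
case: p p0 => [r||]// r0; last first.
  rewrite (exponent_divy n0) /lpball/=.
  split=> /bigmax_leP[_ h]; apply/bigmax_leP; split => // i _.
    have := h i isT; rewrite tnth_mktuple ger0_norm ?powR_ge0//.
    by rewrite powR_le1// invr_gt0.
  rewrite tnth_mktuple ger0_norm ?powR_ge0// powR_le1 ?invr_gt0//.
  exact: h.
rewrite lte_fin in r0; rewrite (exponent_divE r n0) /lpball/=.
rewrite (eq_bigr (fun i => `|tnth t i| `^ (r / n%:R))); last first.
  by move=> i _; rewrite tnth_mktuple ger0_norm ?powR_ge0// -powRrM mulrC.
set S := \sum_(i < m) _.
have S0 : 0 <= S by apply: sumr_ge0 => i _; exact: powR_ge0.
rewrite (powR_le1 S0) ?invr_gt0// (powR_le1 S0)// invr_gt0.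
by rewrite divr_gt0.
Qed.

(** The law of [root_map n t] for [t] uniform on the [l_(p/n)]-ball, by
    [preimage_root_map_lpball]. *)
Definition radial_prob p n m (A : set (m.-tuple R)) : \bar R :=
  (lebesgue_tuple R m (@root_map R n m @^-1` (A `&` lpball p m))
    / lpball_volume (p / n%:R%:E)%E m)%E.

Lemma measurable_polar q m :
  measurable_fun setT (fun x : m.-tuple R => (lpnorm q x, normalize q x)).
Proof.
by apply: measurable_fun_pair; [exact: measurable_lpnorm|exact: measurable_normalize].
Qed.

Lemma measurable_scale_pair m :
  measurable_fun setT (fun z : R * m.-tuple R => scale_tuple z.1 z.2).
Proof.
apply/measurable_fun_tnthP => i; rewrite (_ : _ \o _ =
    fun z : R * m.-tuple R => z.1 * tnth z.2 i); last first.
  by apply/funext => x /=; rewrite tnth_mktuple.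
apply: measurable_funM => //.
exact: (measurableT_comp (measurable_tnth i)).
Qed.

(** The pair of [U^(1/m)] and the Gaussian direction has the law of the pair of norm and direction
    of a uniform point of the ball: on rectangles both are products. Multiplying the two components
    gives the point itself. *)
Lemma uniform_ball_law q m (q0 : (0 < q)%E) (A : set (m.-tuple R)) :
  (0 < m)%N -> measurable A ->
  (@unif_real R \x tuple_prob (gaussian_prob q0) m)%E
    [set z | A (scale_tuple (z.1 `^ m%:R^-1) (normalize q z.2))] =
  (lebesgue_tuple R m (A `&` lpball q m) / lpball_volume q m)%E.
Proof.
move=> m0 mA.
pose F (z : R * m.-tuple R) := (z.1 `^ m%:R^-1, normalize q z.2).
have mF : measurable_fun setT F.
  apply: measurable_fun_pair; first exact: (measurableT_comp (measurable_powR _)).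
  exact: (measurableT_comp (@measurable_normalize R q m)).
have mb : measurable (lpball q m : set (m.-tuple R)) by exact: measurable_lpball.
have Vfin := @lpball_volume_fin_num R _ m q0.
have V0 := lpball_volume_gt0 q0 m0.
have fV0 : 0 < fine (lpball_volume q m) by rewrite fine_gt0// V0 ltey_eq Vfin.
have c0 : 0 <= (fine (lpball_volume q m))^-1 by rewrite invr_ge0 ltW.
have VE : ((fine (lpball_volume q m))^-1%:E = (lpball_volume q m)^-1)%E.
  by rewrite -[in RHS](fineK Vfin) inver gt_eqF.
pose m1 := mpush (@unif_real R \x tuple_prob (gaussian_prob q0) m)%E mF measurableT.
pose m2 := mscale (NngNum c0) (mpush (lebesgue_tuple R m) (@measurable_polar q m) mb).
have m1E B : m1 B = (@unif_real R \x tuple_prob (gaussian_prob q0) m)%E (F @^-1` B).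
  by rewrite /m1 /mpush setIT.
have m2E B : m2 B = (lebesgue_tuple R m
    ((fun x => (lpnorm q x, normalize q x)) @^-1` B `&` lpball q m) / lpball_volume q m)%E.
  by rewrite -VE muleC.
have m12 B : measurable B -> m1 B = m2 B.
  apply: (@pi_generator_unique _ _ R (rects measurable measurable) m1 m2).
  - by apply: pi_generator_rects; exact: pi_generator_measurable.
  - rewrite [X in (X < _)%E]m1E preimage_setT.
    by apply: le_lt_trans (probability_le1 _ _) (ltry 1).
  - move=> _ [C mC [D mD ->]]; apply: etrans (m1E _) (etrans _ (esym (m2E _))).
    rewrite (_ : F @^-1` _ = ((@powR R ^~ m%:R^-1) @^-1` C) `*` (@normalize R q m @^-1` D))//.
    have mpC : measurable ((@powR R ^~ m%:R^-1) @^-1` C).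
      by rewrite -[X in measurable X]setTI; exact: measurable_powR.
    have mnD := measurable_preimage_normalize q mD.
    rewrite product_measure1E// [X in (_ * X)%E]tuple_gaussian_normalize//.
    rewrite [X in (X * _)%E]unif_real_powR//.
    rewrite (_ : _ `&` lpball q m = @lpnorm R q m @^-1` (C `&` `]-oo, 1%R]%classic)
        `&` @normalize R q m @^-1` D); last first.
      apply/seteqP; split => x /=; rewrite /lpball/= in_itv/=.
        by case=> -[].
      by case=> -[].
    rewrite polar_decomposition//; last exact: measurableI.
    by rewrite /angular_prob -!muleA; congr (_ * _)%E; rewrite muleCA.
pose K := (fun z : R * m.-tuple R => scale_tuple z.1 z.2) @^-1` A.
have mK : measurable K.
  by rewrite -[X in measurable X]setTI; exact: measurable_scale_pair.
rewrite -[LHS](m1E K) [LHS]m12// m2E; congr (lebesgue_tuple R m (_ `&` _) / _)%E.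
by apply/seteqP; split => x; rewrite /K/= scale_normalize.
Qed.

(** The [n]-th root turns [U^(1/m)] into [U^(1/(mn))] and the exponent [n/p] of the [l_(p/n)]-norm
    into [1/p]. *)
Lemma radial_repE (r : R) n m (u : R) (z : m.-tuple R) : 0 < r -> (0 < n)%N -> (0 < m)%N ->
  radial_rep r%:E n u (fun i => tnth z i) =
  root_map n (scale_tuple (u `^ m%:R^-1) (normalize (r%:E / n%:R%:E)%E z)).
Proof.
move=> r0 n0 m0; apply/eq_from_tnth => i; rewrite !tnth_mktuple exponent_divE//.
rewrite /root_abs !normrM normfV !powRM ?invr_ge0 ?mulr_ge0 ?normr_ge0 ?invr_ge0//.
rewrite ger0_norm ?powR_ge0// -powRrM natrM invfM; congr (_ * (_ * _)).
have s0 : 0 <= lpnorm (r / n%:R)%:E z by exact: lpnorm_ge0.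
rewrite ger0_norm// -[(lpnorm _ _)^-1]powR_inv1// powRAC powR_inv1 ?powR_ge0//.
congr (_^-1); rewrite /= -powRrM; congr (_ `^ _).
by rewrite invf_div mulrAC divff ?mul1r// pnatr_eq0 gtn_eqF.
Qed.

Lemma radial_rep_law p n m (p0 : (0 < p / n%:R%:E)%E) (A : set (m.-tuple R)) :
  (0 < p)%E -> (0 < n)%N -> (0 < m)%N -> measurable A ->
  (@unif_real R \x tuple_prob (gaussian_prob p0) m)%E
    [set z | A (radial_rep p n z.1 (fun i => tnth z.2 i))] = radial_prob p n A.
Proof.
move=> pp n0 m0 mA; rewrite /radial_prob preimage_setI preimage_root_map_lpball//.
have mrA : measurable (@root_map R n m @^-1` A).
  by rewrite -[X in measurable X]setTI; exact: measurable_root_map.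
case: p p0 pp => [r||]// p0 pp; last first.
  move: p0; rewrite exponent_divy// => p0.
  rewrite (_ : [set z | _] = setT `*` (@root_map R n m @^-1` A)); last first.
    by apply/seteqP; split => z /=; [move=> ?; split|case].
  rewrite product_measure1E// [X in (X * _)%E]probability_setT mul1e.
  exact: tuple_gaussian_y.
rewrite lte_fin in pp; rewrite -(@uniform_ball_law _ m p0)//; congr product_measure1.
by apply/funext => z; congr A; exact: radial_repE.
Qed.

End radial_law.

(** * Uniform distribution on the mixed ball *)

Section mixed_ball_law.
Variables (R : realType) (p q : \bar R) (m n : nat).
Hypotheses (p0 : (0 < p)%E) (q0 : (0 < q)%E) (m0 : (0 < m)%N) (n0 : (0 < n)%N).

Let pn0 : (0 < p / n%:R%:E)%E := exponent_div_gt0 p0 n0.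

(** The mixed ball constrains only the row norms, so it is absorbed into the radial set, and volumes
    factor by [array_polar_decomposition]. *)
Lemma uniform_mixed_ball (A : set (m.-tuple R)) (B : 'I_m -> set (n.-tuple R)) :
  measurable A -> (forall i, measurable (B i)) ->
  uniform_on (lebesgue_array R m n) (mixed_ball p q m n)
    (@row_norms R q m n @^-1` A `&` directions q B) =
  (radial_prob p n A * \prod_i angular_prob q (B i))%E.
Proof.
move=> mA mB.
have mb : measurable (lpball p m : set (m.-tuple R)) by exact: measurable_lpball.
have numE C (D : 'I_m -> set (n.-tuple R)) : measurable C -> (forall i, measurable (D i)) ->
    lebesgue_array R m n ((@row_norms R q m n @^-1` C `&` directions q D) `&`
      mixed_ball p q m n) =
    ((\prod_i (2^-1%:E * lebesgue_tuple R n (sector q (D i)))) *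
     lebesgue_tuple R m (@root_map R n m @^-1` (C `&` lpball p m)))%E.
  move=> mC mD; rewrite -array_polar_decomposition//; last exact: measurableI.
  by rewrite setIAC preimage_setI.
(* The denominator is the numerator with all constraints trivial, so the common factor, the [m]-th
   power of half the ball volume, cancels. *)
have denE : mixed_ball p q m n =
    (@row_norms R q m n @^-1` setT `&` directions q (fun=> setT)) `&` mixed_ball p q m n.
  rewrite preimage_setT setTI /directions (_ : box _ = setT) ?setTI//.
  by apply/seteqP; split.
rewrite /uniform_on [X in (_ / lebesgue_array R m n X)%E]denE !numE// setTI.
rewrite preimage_root_map_lpball// /radial_prob -/(lpball_volume _ _).
have Vfin := @lpball_volume_fin_num R _ n q0.
have Wfin := @lpball_volume_fin_num R _ m pn0.
have V0 : 0 < fine (lpball_volume q n).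
  by rewrite fine_gt0// ltey_eq Vfin lpball_volume_gt0.
have W0 : 0 < fine (lpball_volume (p / n%:R%:E)%E m : \bar R).
  by rewrite fine_gt0// ltey_eq Wfin lpball_volume_gt0.
have Lfin : lebesgue_tuple R m (@root_map R n m @^-1` (A `&` lpball p m)) \is a fin_num.
  rewrite ge0_fin_numE//; apply: (@le_lt_trans _ _ (lpball_volume (p / n%:R%:E)%E m)).
    apply: le_measure; rewrite ?inE.
    - rewrite -[X in measurable X]setTI; apply: measurable_root_map => //.
      exact: measurableI.
    - exact: measurable_lpball.
    - by rewrite preimage_setI preimage_root_map_lpball//; exact: subIsetr.
  exact: lpball_volume_lty.
have prodE (D : 'I_m -> set (n.-tuple R)) : (forall i, measurable (D i)) ->
    (\prod_i (2^-1%:E * lebesgue_tuple R n (sector q (D i))) =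
     ((2^-1 * fine (lpball_volume q n)) ^+ m * \prod_i fine (angular_prob q (D i)))%:E)%E.
  move=> mD; rewrite -[X in _ ^+ X]card_ord -prodr_const -big_split/= -prodEFin.
  apply: eq_bigr => i _; rewrite sector_volume// muleA !EFinM fineK//.
  by rewrite fineK//; exact: angular_prob_fin_num.
have ang1 : \prod_(i < m) fine (angular_prob q (setT : set (n.-tuple R))) = 1.
  rewrite big1// => i _; rewrite /angular_prob /sector preimage_setT setIT.
  by rewrite divee// gt_eqF// lpball_volume_gt0.
have angE : (\prod_i angular_prob q (B i) = (\prod_i fine (angular_prob q (B i)))%:E)%E.
  by rewrite -prodEFin; apply: eq_bigr => i _; rewrite fineK//; exact: angular_prob_fin_num.
have divE (x y : R) : 0 < y -> (x%:E / y%:E = (x / y)%:E)%E.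
  by move=> y0; rewrite inver gt_eqF.
rewrite !prodE// ang1 mulr1 angE -(fineK Lfin) -(fineK Wfin) -!EFinM.
have c0 : 0 < (2^-1 * fine (lpball_volume q n)) ^+ m.
  by rewrite exprn_gt0// mulr_gt0// invr_gt0.
set c := _ ^+ m in c0 *.
rewrite !divE ?mulr_gt0// -EFinM; congr EFin; field.
by rewrite !gt_eqF.
Qed.

Lemma angular_probT : angular_prob q (setT : set (n.-tuple R)) = 1%E.
Proof.
have Vfin := @lpball_volume_fin_num R _ n q0.
rewrite /angular_prob /sector preimage_setT setIT.
by rewrite divee// gt_eqF// lpball_volume_gt0.
Qed.

Lemma radial_probT : radial_prob p n (setT : set (m.-tuple R)) = 1%E.
Proof.
rewrite -(radial_rep_law pn0)// -[RHS](probability_setT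
  (@unif_real R \x tuple_prob (gaussian_prob pn0) m)%E).
by congr product_measure1.
Qed.

Lemma radial_prob_density (A : set (m.-tuple R)) : measurable A ->
  radial_prob p n A = (\int[lebesgue_tuple R m]_(r in A) (radial_pdf p m n r)%:E)%E.
Proof.
move=> mA; have mb : measurable (lpball p m : set (m.-tuple R)) by exact: measurable_lpball.
have Wfin := @lpball_volume_fin_num R _ m pn0.
have W0 : 0 < fine (lpball_volume (p / n%:R%:E)%E m : \bar R).
  by rewrite fine_gt0// ltey_eq Wfin lpball_volume_gt0.
have md : measurable_fun setT (fun t : m.-tuple R => \prod_i root_density n (tnth t i)).
  by apply: (@measurable_tuple_prod _ R R m (fun=> root_density n)) => i;
    exact: measurable_root_density.
rewrite /radial_prob root_map_density//; last exact: measurableI.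
rewrite integral_mkcondr -[in LHS](fineK Wfin) inver gt_eqF// muleC.
rewrite -ge0_integralZl//; last 3 first.
- apply/(measurable_restrict _ _ _) => //; apply/measurable_EFinP/measurable_funTS.
  exact: md.
- move=> t _; apply: erestrict_ge0 => {}t _; rewrite lee_fin prodr_ge0// => i _.
  exact: root_density_ge0.
- by rewrite lee_fin invr_ge0 ltW.
apply: eq_integral => t _; rewrite patchE /radial_pdf.
(* The product of the half-line indicators is the indicator of the nonnegative orthant. *)
have rE : \prod_i root_density n (tnth t i) = (2 * n%:R) ^+ m * \prod_(i < m) tnth t i ^+ n.-1
    * \1_([set r : m.-tuple R | forall i, 0 <= tnth r i]) t.
  rewrite /root_density big_split/= big_split/= prodr_const card_ord; congr (_ * _).
  have [t0|t0] := pselect (forall i, 0 <= tnth t i).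
    rewrite indicE mem_set// big1// => i _.
    by rewrite indicE mem_set//= in_itv/= t0.
  rewrite indicE memNset//; have [i ti] : exists i, ~~ (0 <= tnth t i).
    by apply/not_existsP => h; apply: t0 => i; apply/negPn/negP/h.
  by rewrite (bigD1 i)//= indicE memNset ?mul0r//= in_itv/= andbT; exact/negP.
rewrite indicI /=; case: ifPn => tp.
  have -> : \1_(lpball p m) t = 1 :> R by rewrite indicE tp.
  by rewrite rE -EFinM; congr EFin; ring.
have -> : \1_(lpball p m) t = 0 :> R by rewrite indicE (negbTE tp).
by rewrite mule0 mul0r mulr0.
Qed.

End mixed_ball_law.

Lemma prod_option (R : realType) (I : finType) (F : option I -> \bar R) :
  (\prod_o F o = F None * \prod_i F (Some i))%E.
Proof.
rewrite (bigD1 None)//=; congr (_ * _)%E.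
rewrite (reindex_omap Some id)//=; last by case.
by apply: eq_bigl => i; rewrite eqxx.
Qed.

(** * Independent inputs *)

Section joint_laws.
Variables (R : realType) (p q : \bar R) (m n : nat).
Variables (d : measure_display) (T : measurableType d) (P : probability T R).
Variables (U : {RV P >-> R}) (xi : 'I_m -> {RV P >-> R}).
Variable eta : 'I_m -> 'I_n -> {RV P >-> R}.

Definition tuple_rv k (Y : 'I_k -> {RV P >-> R}) (w : T) : k.-tuple R :=
  [tuple Y i w | i < k].

Definition array_rv (w : T) : m.-tuple (n.-tuple R) :=
  [tuple tuple_rv (eta i) w | i < m].

Lemma measurable_tuple_rv k (Y : 'I_k -> {RV P >-> R}) :
  measurable_fun setT (tuple_rv Y).
Proof.
apply/measurable_fun_tnthP => i; rewrite (_ : _ \o _ = Y i).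
  exact: measurable_funPT.
by apply/funext => w /=; rewrite tnth_mktuple.
Qed.

Lemma measurable_array_rv : measurable_fun setT array_rv.
Proof.
apply/measurable_fun_tnthP => i; rewrite (_ : _ \o _ = tuple_rv (eta i)).
  exact: measurable_tuple_rv.
by apply/funext => w /=; rewrite tnth_mktuple.
Qed.

Lemma preimage_in_g_sigma_algebra (Y : {RV P >-> R}) (B : set R) :
  measurable B -> g_sigma_algebra_preimage Y (Y @^-1` B).
Proof. by move=> mB; exists B => //; rewrite setTI. Qed.

Lemma mpush_probability_lty d' (S : measurableType d') (f : T -> S)
    (mf : measurable_fun setT f) : (mpush P mf measurableT setT < +oo)%E.
Proof.
rewrite /mpush setIT preimage_setT.
by apply: (@le_lt_trans _ _ 1%E); [exact: probability_le1|exact: ltry].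
Qed.

(** A box event is an intersection of one event per variable, so independence and the marginal laws
    give the product measure on the generating boxes. *)
Lemma radial_input_law (pn0 : (0 < p / n%:R%:E)%E) (C : set (R * m.-tuple R)) :
  radial_input p n U xi -> measurable C ->
  P [set w | C (U w, tuple_rv xi w)] =
  (@unif_real R \x tuple_prob (gaussian_prob pn0) m)%E C.
Proof.
case=> ind uU gxi mC.
have mF : measurable_fun setT (fun w => (U w, tuple_rv xi w)).
  by apply: measurable_fun_pair; [exact: measurable_funPT|exact: measurable_tuple_rv].
pose m1 := mpush P mF measurableT.
have m1E B : m1 B = P [set w | B (U w, tuple_rv xi w)] by rewrite /m1 /mpush setIT.
rewrite -m1E.
apply: (@pi_generator_unique _ _ R (rects measurable (boxes m measurable)) m1
  (@unif_real R \x tuple_prob (gaussian_prob pn0) m)%E) => //.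
- apply: pi_generator_rects; first exact: pi_generator_measurable.
  exact/pi_generator_boxes/pi_generator_measurable.
- exact: mpush_probability_lty.
move=> _ [A mA [_ [B mB <-] ->]]; apply: etrans (m1E _) _.
rewrite [RHS]product_measure1E//; last exact: measurable_box.
rewrite [X in (_ * X)%E]tuple_measure_box//.
pose E (o : option 'I_m) := if o is Some i then xi i @^-1` B i else U @^-1` A.
rewrite (_ : [set w | _] = \bigcap_o E o); last first.
  apply/seteqP; split => w /=.
    by case=> UA xiB [i|] _ //=; have := xiB i; rewrite tnth_mktuple.
  move=> h; split; first exact: (h None).
  by move=> i; rewrite tnth_mktuple; exact: (h (Some i)).
rewrite ind; last by case=> [i|]; exact: preimage_in_g_sigma_algebra.
rewrite prod_option /E; congr (_ * _)%E; first exact: uU.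
by apply: eq_bigr => i _; exact: gxi.
Qed.

Lemma angular_input_law (q0 : (0 < q)%E) (i : 'I_m) (C : set (n.-tuple R)) :
  angular_input q eta -> measurable C ->
  P [set w | C (tuple_rv (eta i) w)] = tuple_prob (gaussian_prob q0) n C.
Proof.
case=> ind geta mC; have mF := measurable_tuple_rv (eta i).
pose m1 := mpush P mF measurableT.
have m1E B : m1 B = P [set w | B (tuple_rv (eta i) w)] by rewrite /m1 /mpush setIT.
rewrite -m1E.
apply: (@pi_generator_unique _ _ R (boxes n measurable) m1
  (tuple_prob (gaussian_prob q0) n)) => //.
- exact/pi_generator_boxes/pi_generator_measurable.
- exact: mpush_probability_lty.
move=> _ [B mB <-]; apply: etrans (m1E _) _; rewrite [RHS]tuple_measure_box//.
(* Independence is a product rule over the whole array; the other rows are filled with sure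
   events. *)
pose B' (ij : 'I_m * 'I_n) := if ij.1 == i then B ij.2 else setT.
have mB' ij : measurable (B' ij) by rewrite /B'; case: ifP.
rewrite (_ : [set w | _] = \bigcap_ij (eta ij.1 ij.2 @^-1` B' ij)); last first.
  apply/seteqP; split => w /=.
    move=> h [i' j] _ /=; rewrite /B'/=; case: eqP => // ->.
    by have := h j; rewrite tnth_mktuple.
  by move=> h j; have := h (i, j) Logic.I; rewrite /B'/= eqxx tnth_mktuple.
rewrite ind; last by move=> ij; exact: preimage_in_g_sigma_algebra.
rewrite -(pair_bigA _ (fun i' j => P (eta i' j @^-1` B' (i', j))))/=.
rewrite (bigD1 i)//= [X in (_ * X)%E]big1 ?mule1.
  by apply: eq_bigr => j _; rewrite /B'/= eqxx; exact: geta.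
move=> i' i'i; apply: big1 => j _; rewrite /B'/= (negbTE i'i) preimage_setT.
exact: probability_setT.
Qed.

Lemma joint_input_law (pn0 : (0 < p / n%:R%:E)%E) (q0 : (0 < q)%E)
    (C : set ((R * m.-tuple R) * m.-tuple (n.-tuple R))) :
  joint_input p q U xi eta -> measurable C ->
  P [set w | C ((U w, tuple_rv xi w), array_rv w)] =
  ((@unif_real R \x tuple_prob (gaussian_prob pn0) m)
    \x tuple_prob (tuple_prob (gaussian_prob q0) n) m)%E C.
Proof.
case=> ind uU gxi geta mC.
have mF : measurable_fun setT (fun w => ((U w, tuple_rv xi w), array_rv w)).
  apply: measurable_fun_pair; last exact: measurable_array_rv.
  by apply: measurable_fun_pair; [exact: measurable_funPT|exact: measurable_tuple_rv].
pose m1 := mpush P mF measurableT.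
have m1E B : m1 B = P [set w | B ((U w, tuple_rv xi w), array_rv w)].
  by rewrite /m1 /mpush setIT.
rewrite -m1E.
apply: (@pi_generator_unique _ _ R
  (rects (rects measurable (boxes m measurable)) (boxes m (boxes n measurable))) m1
  ((@unif_real R \x tuple_prob (gaussian_prob pn0) m)
    \x tuple_prob (tuple_prob (gaussian_prob q0) n) m)%E) => //.
- apply: pi_generator_rects; last first.
    exact/pi_generator_boxes/pi_generator_boxes/pi_generator_measurable.
  apply: pi_generator_rects; first exact: pi_generator_measurable.
  exact/pi_generator_boxes/pi_generator_measurable.
- exact: mpush_probability_lty.
move=> _ [_ [A mA [_ [B mB <-] ->]] [_ [D bD <-] ->]]; apply: etrans (m1E _) _.
(* Each [D i] is only known to be some box of [R^n]; its sides are chosen for all rows at once to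
   express the event by single variables. *)
have /choice[D' D'E] : forall i, exists D' : 'I_n -> set R,
    (forall j, measurable (D' j)) /\ D i = box D'.
  by move=> i; have [D' mD' DE] := bD i; exists D'.
have mD i : measurable (D i).
  by rewrite (D'E i).2; apply: measurable_box; exact: (D'E i).1.
rewrite [RHS]product_measure1E//; last 2 first.
- by apply: measurableX => //; exact: measurable_box.
- exact: measurable_box.
rewrite [X in (X * _)%E]product_measure1E//; last exact: measurable_box.
rewrite [X in (_ * X * _)%E]tuple_measure_box// [X in (_ * X)%E]tuple_measure_box//.
pose E (o : option ('I_m + 'I_m * 'I_n)) := match o with
  | None => U @^-1` A
  | Some (inl i) => xi i @^-1` B i
  | Some (inr ij) => eta ij.1 ij.2 @^-1` D' ij.1 ij.2
  end.
rewrite (_ : [set w | _] = \bigcap_o E o); last first.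
  apply/seteqP; split => w /=.
    case=> -[UA xiB] etaD [[i|[i j]]|] _ //=; first by have := xiB i; rewrite tnth_mktuple.
    by have := etaD i; rewrite (D'E i).2 tnth_mktuple => /(_ j); rewrite tnth_mktuple.
  move=> h; split; first split; first exact: (h None).
    by move=> i; rewrite tnth_mktuple; exact: (h (Some (inl i))).
  move=> i; rewrite (D'E i).2 tnth_mktuple => j; rewrite tnth_mktuple.
  exact: (h (Some (inr (i, j)))).
rewrite ind; last first.
  case=> [[i|[i j]]|]; apply: preimage_in_g_sigma_algebra => //.
  exact: (D'E i).1.
rewrite prod_option big_sumType /E /= -muleA; congr (_ * (_ * _))%E; first exact: uU.
  by apply: eq_bigr => i _; exact: gxi.
rewrite -(pair_bigA _ (fun i j => P (eta i j @^-1` D' i j)))/=.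
apply: eq_bigr => i _; rewrite (D'E i).2 [RHS]tuple_measure_box; last exact: (D'E i).1.
by apply: eq_bigr => j _; apply: geta; exact: (D'E i).1.
Qed.

End joint_laws.

(** * Cone measure *)

Section cone_measure.
Variables (R : realType) (q : \bar R) (n : nat).
Hypotheses (q0 : (0 < q)%E) (n0 : (0 < n)%N).

(** Cone and sector agree off the origin, the only point of [Z]. The origin lies in the cone when
    [A] meets the sphere, and in the sector when [A] contains 0. *)
Lemma cone_measureE (A : set (n.-tuple R)) : measurable A ->
  cone_measure q (A `&` lpsphere q n) = angular_prob q A.
Proof.
move=> mA; pose Z : set (n.-tuple R) := @lpnorm R q n @^-1` `]-oo, 0]%classic.
have mZ : measurable Z by exact: measurable_preimage_lpnorm.
have Z0 : lebesgue_tuple R n Z = 0%E.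
  by apply: (@lpnorm_le0_null R q n q0 n0 Z mZ) => x; rewrite /Z/= in_itv.
have ZP x : Z x <-> x = scale_tuple 0 x.
  rewrite /Z/= in_itv/=; split=> [Nx|->].
    apply/eq_from_tnth => i; rewrite tnth_mktuple mul0r; apply/eqP.
    by rewrite -normr_le0 (le_trans (le_lpnorm x i q0)).
  by rewrite lpnorm_scale// mul0r.
have msA := measurable_sector q mA.
have mD : measurable (sector q A `\` Z) by exact: measurableD.
have sE : lebesgue_tuple R n (sector q A `\` Z) = lebesgue_tuple R n (sector q A).
  rewrite -(measureU0 mD mZ Z0) -(measureU0 msA mZ Z0); congr (lebesgue_tuple R n _).
  by apply/seteqP; split => x [sx|Zx]; [left; case: sx|right| |right] => //;
    have [Zx|Zx] := pselect (Z x); [right|left].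
have addZ : lebesgue_tuple R n ((sector q A `\` Z) `|` Z) = lebesgue_tuple R n (sector q A).
  by rewrite measureU0.
have sphereP x : ~ Z x -> lpsphere q n (normalize q x).
  move=> Zx; have N0 : 0 < lpnorm q x.
    by rewrite ltNge; apply/negP => Nx; apply: Zx; rewrite /Z/= in_itv.
  have -> : normalize q x = scale_tuple (lpnorm q x)^-1 x.
    by apply/eq_from_tnth => i; rewrite !tnth_mktuple mulrC.
  by rewrite /lpsphere/= lpnorm_scale ?invr_ge0 ?ltW// mulVf// gt_eqF.
have coneP x : ~ Z x -> cone (A `&` lpsphere q n) x <-> (sector q A `\` Z) x.
  move=> Zx; split.
    case=> s /=; rewrite in_itv/= => /andP[s0 s1] [a [Aa Na] xE].
    have {}xE : x = scale_tuple s a by rewrite -xE.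
    have s0' : 0 < s.
      rewrite lt_neqAle s0 andbT; apply/eqP => s0E; apply: Zx.
      by rewrite xE /Z/= in_itv/= lpnorm_scale// -s0E mul0r.
    split=> //; split; rewrite /lpball/= xE.
      by rewrite lpnorm_scale// Na mulr1.
    rewrite normalize_scale// (_ : normalize q a = a)//.
    by apply/eq_from_tnth => i; rewrite tnth_mktuple Na divr1.
  case=> -[Nx Ax] _; exists (lpnorm q x) => /=; first by rewrite in_itv/= lpnorm_ge0.
  exists (normalize q x); first by split=> //; exact: sphereP.
  exact: scale_normalize.
rewrite /cone_measure /angular_prob; congr (_ / _)%E.
(* The cone is not known to be measurable, so it is identified exactly: it is the sector without the
   origin, with the origin added if [A] meets the sphere, and it is empty otherwise. *)
have [[a AS]|AS] := pselect (exists a, (A `&` lpsphere q n) a).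
  rewrite -addZ; congr (lebesgue_tuple R n _); apply/seteqP; split => x.
    by have [Zx _|Zx /(coneP _ Zx)] := pselect (Z x); [right|left].
  case=> [[sx Zx]|Zx]; first by apply/(coneP _ Zx).
  exists 0; first by rewrite /= in_itv/= lexx ler01.
  exists a => //; rewrite (ZP x).1//.
  by apply/eq_from_tnth => i; rewrite !tnth_mktuple !mul0r.
rewrite -sE; congr (lebesgue_tuple R n _); apply/seteqP; split => x.
  by case=> s _ [a Aa _]; exfalso; apply: AS; exists a.
by move=> sx; apply/(coneP _ sx.2).
Qed.

End cone_measure.

(** * Existence of the independent inputs *)

Section existence.
Variables (R : realType) (p q : \bar R) (m n : nat).
Hypotheses (pn0 : (0 < p / n%:R%:E)%E) (q0 : (0 < q)%E).

Let S : Type := ((R * m.-tuple R) * m.-tuple (n.-tuple R))%type.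

Let PS : probability ((R * m.-tuple R) * m.-tuple (n.-tuple R))%type R :=
  ((@unif_real R \x tuple_prob (gaussian_prob pn0) m)
    \x tuple_prob (tuple_prob (gaussian_prob q0) n) m)%E.

(** The witnesses are the coordinates of the product space. *)
Lemma joint_input_exists :
  exists (d' : measure_display) (T' : measurableType d')
    (P' : probability T' R) (U : {RV P' >-> R}) (xi : 'I_m -> {RV P' >-> R})
    (eta : 'I_m -> 'I_n -> {RV P' >-> R}), joint_input p q U xi eta.
Proof.
have mU : measurable_fun setT (fun z : S => z.1.1).
  exact: (measurableT_comp measurable_fst measurable_fst).
have mxi i : measurable_fun setT (fun z : S => tnth z.1.2 i).
  apply: (measurableT_comp (measurable_tnth i)).
  exact: (measurableT_comp measurable_snd measurable_fst).
have meta i j : measurable_fun setT (fun z : S => tnth (tnth z.2 i) j).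
  apply: (measurableT_comp (measurable_tnth j)).
  exact: (measurableT_comp (measurable_tnth i) measurable_snd).
pose U : {RV PS >-> R} := HB.pack (fun z : S => z.1.1) (isMeasurableFun.Build _ _ _ _ _ mU).
pose xi i : {RV PS >-> R} := HB.pack (fun z : S => tnth z.1.2 i)
  (isMeasurableFun.Build _ _ _ _ _ (mxi i)).
pose eta i j : {RV PS >-> R} := HB.pack (fun z : S => tnth (tnth z.2 i) j)
  (isMeasurableFun.Build _ _ _ _ _ (meta i j)).
exists _, _, PS, U, xi, eta.
pose Y (o : option ('I_m + 'I_m * 'I_n)) : {RV PS >-> R} := match o with
  | None => U | Some (inl i) => xi i | Some (inr ij) => eta ij.1 ij.2 end.
pose law (o : option ('I_m + 'I_m * 'I_n)) : probability R R := match o with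
  | None => @unif_real R
  | Some (inl _) => gaussian_prob pn0
  | Some (inr _) => gaussian_prob q0 end.
(* One product rule for all variables; the marginals [marg] follow by putting [setT] everywhere
   else, and the two together give independence. *)
have rect B : (forall o, measurable (B o)) ->
    PS (\bigcap_o (Y o @^-1` B o)) = (\prod_o law o (B o))%E.
  move=> mB; rewrite (_ : \bigcap_o _ =
      ((B None `*` box (fun i => B (Some (inl i)))) `*`
       box (fun i => box (fun j => B (Some (inr (i, j))))))); last first.
    apply/seteqP; split => z /=.
      move=> h; split; first split; first exact: (h None Logic.I).
        by move=> i; exact: (h (Some (inl i)) Logic.I).
      by move=> i j; exact: (h (Some (inr (i, j))) Logic.I).
    by case=> -[zU zxi] zeta [[i|[i j]]|] _ /=; [exact: zxi|exact: zeta|exact: zU].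
  have mb2 i : measurable (box (fun j => B (Some (inr (i, j))))) by exact: measurable_box.
  rewrite [LHS]product_measure1E//; last 2 first.
  - by apply: measurableX => //; exact: measurable_box.
  - exact: measurable_box.
  rewrite [X in (X * _)%E]product_measure1E//; last exact: measurable_box.
  rewrite [X in (_ * X * _)%E]tuple_measure_box// [X in (_ * X)%E]tuple_measure_box//.
  rewrite prod_option big_sumType /= -muleA; congr (_ * (_ * _))%E.
  rewrite [RHS](eq_bigr (fun ij => gaussian_prob q0 (B (Some (inr (ij.1, ij.2))))));
    last by case.
  rewrite -(pair_bigA _ (fun i j => gaussian_prob q0 (B (Some (inr (i, j))))))/=.
  by apply: eq_bigr => i _; rewrite [LHS]tuple_measure_box.
have marg o A : measurable A -> PS (Y o @^-1` A) = law o A.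
  move=> mA; pose B o' := if o' == o then A else setT.
  have mB o' : measurable (B o') by rewrite /B; case: ifP.
  have <- : (\prod_o' law o' (B o') = law o A)%E.
    rewrite (bigD1 o)//= big1 ?mule1 /B ?eqxx// => o' /negbTE ->.
    exact: probability_setT.
  rewrite -rect//; congr product_measure1; apply/seteqP; split => z /=.
    by move=> Az o' _; rewrite /B; case: eqP => // ->.
  by move=> /(_ o Logic.I); rewrite /B eqxx.
split.
- move=> E EY; have /choice[B BE] : forall o, exists B, measurable B /\ E o = Y o @^-1` B.
    move=> o; have [B mB <-] := EY o; exists B; split=> //; rewrite setTI.
    by case: o {mB} => [[i|ij]|].
  rewrite (eq_bigcapr (fun o _ => (BE o).2)) rect; last by move=> o; exact: (BE o).1.
  by apply: eq_bigr => o _; rewrite (BE o).2 [RHS]marg//; exact: (BE o).1.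
- by move=> A mA; exact: (marg None).
- by move=> i A mA; exact: (marg (Some (inl i))).
- by move=> i j A mA; exact: (marg (Some (inr (i, j)))).
Qed.

End existence.

(** * Measurability of the representation and reconstruction of the array *)

Lemma measurable_radial_rep (R : realType) (p : \bar R) n m :
  (0 < p)%E -> (0 < n)%N -> (0 < m)%N ->
  measurable_fun setT (fun z : R * m.-tuple R =>
    radial_rep p n z.1 (fun i => tnth z.2 i)).
Proof.
case: p => [r||]// p0 n0 m0; last first.
  exact: (measurableT_comp (@measurable_root_map R m n) measurable_snd).
rewrite lte_fin in p0; rewrite (_ : (fun z => _) = @root_map R n m \o
    ((fun z => scale_tuple z.1 z.2) \o
     (fun z => (z.1 `^ m%:R^-1, normalize (r%:E / n%:R%:E)%E z.2)))); last first.
  by apply/funext => z; exact: radial_repE.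
apply: measurableT_comp; first exact: measurable_root_map.
apply: measurableT_comp; first exact: measurable_scale_pair.
apply: measurable_fun_pair; first exact: (measurableT_comp (measurable_powR _)).
exact: (measurableT_comp (@measurable_normalize R _ m)).
Qed.

Section reconstruction.
Variables (R : realType) (m n : nat).

(** A left inverse of the passage to radii and directions; as it is measurable, the joint law of
    these determines the law of the array. *)
Definition polar_product (z : m.-tuple R * m.-tuple (n.-tuple R)) :
    m.-tuple (n.-tuple R) :=
  [tuple scale_tuple (tnth z.1 i) (tnth z.2 i) | i < m].

Lemma measurable_polar_product : measurable_fun setT polar_product.
Proof.
apply/measurable_fun_tnthP => i; rewrite (_ : _ \o _ =
    (fun z => scale_tuple z.1 z.2) \o
    (fun z : m.-tuple R * m.-tuple (n.-tuple R) => (tnth z.1 i, tnth z.2 i))).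
  apply: measurableT_comp; first exact: measurable_scale_pair.
  apply: measurable_fun_pair.
    exact: (measurableT_comp (measurable_tnth i) measurable_fst).
  exact: (measurableT_comp (measurable_tnth i) measurable_snd).
by apply/funext => z /=; rewrite tnth_mktuple.
Qed.

End reconstruction.

Theorem proposition1 (R : realType) (p q : \bar R) (m n : nat)
    (hp : (0 < p)%E) (hq : (0 < q)%E) (hm : (0 < m)%N) (hn : (0 < n)%N)
    (d : measure_display) (T : measurableType d) (P : probability T R)
    (X : {RV P >-> m.-tuple (n.-tuple R)})
    (hX : forall A : set (m.-tuple (n.-tuple R)), measurable A ->
       distribution P X A =
       uniform_on (lebesgue_array R m n) (mixed_ball p q m n) A) :
  let Rad : T -> m.-tuple R := fun w => row_norms q (X w) in
  let Theta (i : 'I_m) : T -> n.-tuple R := fun w => normalize q (tnth (X w) i) in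
  (* almost sure well-definedness of the Theta_i, and existence of the
     independent variables used in the representations below *)
  ({ae P, forall w, forall i : 'I_m, tnth (Rad w) i != 0} /\
   (exists (d' : measure_display) (T' : measurableType d')
      (P' : probability T' R) (U : {RV P' >-> R}) (xi : 'I_m -> {RV P' >-> R})
      (eta : 'I_m -> 'I_n -> {RV P' >-> R}), joint_input p q U xi eta)) /\
  [/\ (* (a) *)
      has_density P Rad (lebesgue_tuple R m) (radial_pdf p m n) /\
      (forall (d' : measure_display) (T' : measurableType d')
         (P' : probability T' R) (U : {RV P' >-> R})
         (xi : 'I_m -> {RV P' >-> R}),
         radial_input p n U xi ->
         eq_dist P Rad P' (fun w => radial_rep p n (U w) (fun i => xi i w))),
      (* (b) *)
      [/\ mutually_independent P (fun o : option 'I_m =>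
            if o is Some i then g_sigma_algebra_preimage (Theta i)
            else g_sigma_algebra_preimage Rad),
          forall (i : 'I_m) (A : set (n.-tuple R)), measurable A ->
            pushforward P (Theta i) A = cone_measure q (A `&` lpsphere q n)
        & forall (d' : measure_display) (T' : measurableType d')
            (P' : probability T' R) (eta : 'I_m -> 'I_n -> {RV P' >-> R}),
            angular_input q eta ->
            forall i : 'I_m,
              eq_dist P (Theta i)
                P' (fun w => angular_rep q (fun j => eta i j w))]
    & (* (c) *)
      {ae P, forall w, forall (i : 'I_m) (j : 'I_n),
         tnth (tnth (X w) i) j = tnth (Rad w) i * tnth (Theta i w) j} /\
      (forall (d' : measure_display) (T' : measurableType d')
         (P' : probability T' R) (U : {RV P' >-> R})
         (xi : 'I_m -> {RV P' >-> R}) (eta : 'I_m -> 'I_n -> {RV P' >-> R}),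
         joint_input p q U xi eta ->
         eq_dist P X
           P' (fun w => array_rep p q (U w) (fun i => xi i w)
                          (fun i j => eta i j w)))].
Proof.
move=> Rad Theta.
have pn0 := exponent_div_gt0 hp hn.
have mRad : measurable_fun setT Rad.
  exact: (measurableT_comp (@measurable_row_norms R q m n) (measurable_funPT X)).
have mTheta i : measurable_fun setT (Theta i).
  apply: (measurableT_comp (@measurable_normalize R q n)).
  exact: (measurableT_comp (measurable_tnth i) (measurable_funPT X)).
(* The joint law of radii and directions. The marginals [lawR] and [lawT] are obtained from it with
   trivial constraints, and independence then amounts to the product form. *)
have lawRT A B : measurable A -> (forall i, measurable (B i)) ->
    P [set w | A (Rad w) /\ forall i, B i (Theta i w)] =
    (radial_prob p n A * \prod_i angular_prob q (B i))%E.
  move=> mA mB; rewrite -uniform_mixed_ball//; apply: hX.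
  apply: measurableI; last exact: measurable_directions.
  by rewrite -[X in measurable X]setTI; exact: measurable_row_norms.
have lawR A : measurable A -> P (Rad @^-1` A) = radial_prob p n A.
  move=> mA; transitivity (P [set w | A (Rad w) /\ forall i, setT (Theta i w)]).
    by congr (P _); apply/seteqP; split => w //= [].
  rewrite (lawRT A (fun=> setT))//.
  by rewrite big1 ?mule1// => i _; exact: angular_probT.
have lawT i B : measurable B -> P (Theta i @^-1` B) = angular_prob q B.
  move=> mB; pose B' j := if j == i then B else setT.
  have mB' j : measurable (B' j) by rewrite /B'; case: ifP.
  transitivity (P [set w | setT (Rad w) /\ forall j, B' j (Theta j w)]).
    congr (P _); apply/seteqP; split => w /=.
      by move=> Bw; split=> // j; rewrite /B'; case: eqP => // ->.
    by case=> _ /(_ i); rewrite /B' eqxx.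
  rewrite (lawRT setT B')// radial_probT// mul1e (bigD1 i)//= /B' eqxx big1 ?mule1//.
  by move=> j /negbTE ->; exact: angular_probT.
have repE d' (T' : measurableType d') (P' : probability T' R) (xi : 'I_m -> {RV P' >-> R}) u w :
    radial_rep p n u (fun i => xi i w) = radial_rep p n u (fun i => tnth (tuple_rv xi w) i).
  by congr (radial_rep p n u _); apply/funext => i; rewrite tnth_mktuple.
have mrep A : measurable A ->
    measurable [set z : R * m.-tuple R | A (radial_rep p n z.1 (fun i => tnth z.2 i))].
  by move=> mA; rewrite -[X in measurable X]setTI; exact: measurable_radial_rep.
split; split.
- have H : forall i : 'I_m, {ae P, forall w, tnth (Rad w) i != 0}.
    (* The law of the radii is an image of Lebesgue measure on a ball under [root_map n], and a
       vanishing [i]-th radius comes only from the null hyperplane of points with zero [i]-th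
       coordinate. *)
    move=> i; pose A (j : 'I_m) : set R := if j == i then [set 0] else setT.
    have mA j : measurable (A j) by rewrite /A; case: ifP.
    have mbA := measurable_box mA.
    exists (Rad @^-1` box A); split.
    + by rewrite -[X in measurable X]setTI; exact: mRad.
    + rewrite lawR// /radial_prob (_ : lebesgue_tuple R m _ = 0%E) ?mul0e//.
      apply/eqP; rewrite eq_le measure_ge0 andbT.
      have mr B : measurable B -> measurable (@root_map R n m @^-1` B).
        by move=> mB; rewrite -[X in measurable X]setTI; exact: measurable_root_map.
      apply: (@le_trans _ _ (lebesgue_tuple R m (box A))).
        apply: le_measure; rewrite ?inE//.
          apply: (mr (box A `&` lpball p m)); apply: measurableI => //.
          exact: measurable_lpball.
        move=> t [/= At _] j; have := At j; rewrite /A tnth_mktuple.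
        case: ifP => // _ /= /eqP; rewrite powR_eq0 normr_eq0 => /andP[/eqP t0 _].
        exact: t0.
      rewrite lebesgue_tuple_box// (bigD1 i)//= /A eqxx.
      by rewrite /lebesgue_real lebesgue_measure_set1 mul0e.
    + move=> w /= /negP/negbNE/eqP Rw j; rewrite /A; case: eqP => // ->.
      exact: Rw.
  exact: filter_forall.
- exact: joint_input_exists.
- split.
    by move=> A mA; rewrite /pushforward lawR// radial_prob_density.
  move=> d' T' P' U xi inp A mA; rewrite /pushforward lawR//.
  rewrite -(radial_rep_law pn0)//.
  rewrite -(radial_input_law pn0 inp (mrep A mA)).
  by congr (P' _); apply/funext => w; congr A; rewrite /= repE.
- split.
  + move=> E EF.
    have [A mA AE] := EF None.
    have /choice[B BE] : forall i, exists B, measurable B /\ E (Some i) = Theta i @^-1` B.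
      by move=> i; have [B mB <-] := EF (Some i); exists B; rewrite setTI.
    rewrite prod_option -AE setTI lawR//.
    rewrite (eq_bigr (fun i => angular_prob q (B i))); last first.
      by move=> i _; rewrite (BE i).2 lawT//; exact: (BE i).1.
    rewrite -lawRT//; last by move=> i; exact: (BE i).1.
    congr (P _); apply/seteqP; split => w /=.
      move=> h; split; first by have := h None Logic.I; rewrite -AE => -[].
      by move=> i; have := h (Some i) Logic.I; rewrite (BE i).2.
    case=> Aw Bw [i|] _; first by rewrite (BE i).2; exact: Bw.
    by rewrite -AE.
  + by move=> i A mA; rewrite /pushforward lawT// cone_measureE.
  + move=> d' T' P' eta inp i A mA; rewrite /pushforward lawT//.
    rewrite -(tuple_gaussian_normalize hq)//.
    have mNA := measurable_preimage_normalize q mA.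
    by rewrite -[LHS](angular_input_law hq i inp mNA).
(* This holds for every [w], even where a row vanishes, so the almost sure identity is immediate. *)
- have XE w : X w = polar_product (Rad w, [tuple Theta i w | i < m]).
    apply/eq_from_tnth => i; rewrite !tnth_mktuple.
    by rewrite /Theta scale_normalize.
  split.
    apply: aeW => w i j; rewrite {1}XE !tnth_mktuple//.
  move=> d' T' P' U xi eta inp C mC.
  (* The pairs [f] and [g] of radii and directions are compared first, on rectangles where both laws
     factor; [polar_product] then carries the equality to the arrays. *)
  pose f w := (Rad w, [tuple Theta i w | i < m]).
  pose g w := (radial_rep p n (U w) (fun i => xi i w),
               [tuple angular_rep q (fun j => eta i j w) | i < m]).
  have mf : measurable_fun setT f.
    apply: measurable_fun_pair => //; apply/measurable_fun_tnthP => i.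
    rewrite (_ : _ \o _ = Theta i)//.
    by apply/funext => w /=; rewrite tnth_mktuple.
  have mg : measurable_fun setT g.
    apply: measurable_fun_pair.
      rewrite (_ : (fun w => _) = (fun z => radial_rep p n z.1 (fun i => tnth z.2 i)) \o
          (fun w => (U w, tuple_rv xi w))); last first.
        by apply/funext => w; exact: repE.
      apply: measurableT_comp; first exact: measurable_radial_rep.
      by apply: measurable_fun_pair; [exact: measurable_funPT|exact: measurable_tuple_rv].
    apply/measurable_fun_tnthP => i.
    rewrite (_ : _ \o _ = @normalize R q n \o tuple_rv (eta i)); last first.
      by apply/funext => w /=; rewrite tnth_mktuple.
    apply: measurableT_comp; first exact: measurable_normalize.
    exact: measurable_tuple_rv.
  pose m1 := mpush P mf measurableT; pose m2 := mpush P' mg measurableT.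
  have m1E B : m1 B = P (f @^-1` B) by rewrite /m1 /mpush setIT.
  have m2E B : m2 B = P' (g @^-1` B) by rewrite /m2 /mpush setIT.
  have m12 B : measurable B -> m1 B = m2 B.
    apply: (@pi_generator_unique _ _ R (rects measurable (boxes m measurable)) m1 m2).
    - apply: pi_generator_rects; first exact: pi_generator_measurable.
      exact/pi_generator_boxes/pi_generator_measurable.
    - exact: mpush_probability_lty.
    move=> _ [A mA [_ [D mD <-] ->]]; apply: etrans (m1E _) (etrans _ (esym (m2E _))).
    transitivity (radial_prob p n A * \prod_i angular_prob q (D i))%E.
      rewrite -lawRT//; congr (P _); apply/seteqP; split => w /=.
        by case=> Aw Dw; split=> // i; have := Dw i; rewrite tnth_mktuple.
      by case=> Aw Dw; split=> // i; rewrite tnth_mktuple.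
    (* The event as a rectangle in the space of inputs: its radial side depends on [U] and [xi], its
       angular side on [eta], so [joint_input_law] splits it. *)
    pose K : set ((R * m.-tuple R) * m.-tuple (n.-tuple R)) :=
      [set z | A (radial_rep p n z.1 (fun i => tnth z.2 i))] `*` directions q D.
    have mDD := measurable_directions q mD.
    have mK : measurable K by apply: measurableX => //; exact: mrep.
    transitivity (P' [set w | K ((U w, tuple_rv xi w), array_rv eta w)]).
      rewrite (joint_input_law pn0 hq inp mK) /K [RHS]product_measure1E//; last exact: mrep.
      rewrite [X in (_ = X * _)%E]radial_rep_law//; congr (_ * _)%E.
      rewrite [RHS]tuple_measure_box//; last first.
        by move=> i; exact: measurable_preimage_normalize.
      by apply: eq_bigr => i _; rewrite [RHS]tuple_gaussian_normalize.
    congr (P' _); apply/seteqP; split => w /=; rewrite /K/= -repE.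
      by case=> Aw Dw; split=> // i; have := Dw i; rewrite !tnth_mktuple.
    by case=> Aw Dw; split=> // i; have := Dw i; rewrite !tnth_mktuple.
  have mpC : measurable (@polar_product R m n @^-1` C).
    by rewrite -[X in measurable X]setTI; exact: measurable_polar_product.
  transitivity (m1 (@polar_product R m n @^-1` C)).
    rewrite m1E /pushforward; congr (P _); apply/funext => w; congr C.
    exact: XE.
  rewrite m12// m2E /pushforward; congr (P' _); apply/funext => w; congr C.
  by apply/eq_from_tnth => i; rewrite !tnth_mktuple.
Qed.
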